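(* Let $X\subseteq\{0,1\}^{\mathbb Z}$ be a measure-theoretically subordinate subshift with base measure $\nu$ such that $h(\nu)=0$, and let $\varphi\colon X\to\mathbb R$ be of the form $\varphi(x)=\varphi(x_0)$. Then \[ \mathcal P_{X,\varphi}=\nu(0)\varphi(0)+\nu(1)\log_2\big(2^{\varphi(0)}+2^{\varphi(1)}\big), \] and there is a unique equilibrium state, namely $M_*(\nu\otimes B_p)$ with $p=2^{\varphi(0)}/(2^{\varphi(0)}+2^{\varphi(1)})$.
   Context: $\sigma$ is the left shift on $\{0,1\}^{\mathbb Z}$; $\mathcal M(Y)$ is the set of shift-invariant Borel probability measures on $Y$; $\nu(a)=\nu(\{x:x_0=a\})$. $B_p$ is the Bernoulli measure on $\{0,1\}^{\mathbb Z}$ with probability $p$ of the symbol $0$ and $1-p$ of the symbol $1$. Topological pressure of a subshift $X$ and continuous $\varphi$: $\mathcal P_{X,\varphi}=\lim_n\frac1n\log_2\sum_{A\in\mathcal L_n(X)}2^{\sup_{x\in A}\varphi^{(n)}(x)}$, where $\mathcal L_n(X)$ is the set of $n$-blocks occurring in $X$ (identified with cylinders) and $\varphi^{(n)}=\sum_{j<n}\varphi\circ\sigma^j$; by the variational principle $\mathcal P_{X,\varphi}=\sup_{\mu\in\mathcal M(X)}(h(\mu)+\int\varphi\,d\mu)$ (entropy base 2), and an equilibrium state is a measure attaining this supremum. $M(x,y)=x\cdot y$ coordinatewise, $\pi_1$ the first-coordinate projection. A subshift $X$ is a measure-theoretically subordinate subshift with base measure $\nu$ if $\mathcal M(X)=\{M_*(\lambda):\lambda\in\mathcal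 M((\{0,1\}^{\mathbb Z})^2,\sigma^{\times2}),(\pi_1)_*\lambda=\nu\}$. *)

(* Defs.v *)
From HB Require Import structures.
From mathcomp Require Import all_boot all_order all_algebra.
From mathcomp Require Import all_classical all_reals all_analysis.
Set Implicit Arguments.
Unset Strict Implicit.
Unset Printing Implicit Defensive.
Import Order.TTheory GRing.Theory Num.Theory.
Import numFieldNormedType.Exports.
Local Open Scope classical_set_scope.
Local Open Scope ring_scope.

(* Symbols: 0 is encoded by [false], 1 by [true]. Points of {0,1}^Z. *)
Definition conf := int -> bool.

(* The Borel sigma-algebra of the product topology on {0,1}^Z, i.e. the one
   generated by the elementary cylinders {x | x_i = b}. *)
Definition cylgen : set (set conf) :=
  [set A | exists (i : int) (b : bool), A = [set x | x i = b]].
Definition Omega := g_sigma_algebraType cylgen.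

Definition shift (x : conf) : conf := fun i => x (i + 1)%R.

Definition subshift (X : set conf) : Prop :=
  closed (X : set {ptws int -> bool}) /\ shift @` X = X.

Definition shift_inv (R : realType) (mu : probability Omega R) : Prop :=
  forall A : set Omega, measurable A -> mu (shift @^-1` A) = mu A.

Definition inv_on (R : realType) (X : set conf) (mu : probability Omega R) : Prop :=
  shift_inv mu /\ mu (X : set Omega) = 1%E.

Definition shift_inv2 (R : realType) (lam : probability (Omega * Omega)%type R) : Prop :=
  forall A : set (Omega * Omega), measurable A ->
    lam ((fun z : Omega * Omega => (shift z.1, shift z.2)) @^-1` A) = lam A.

Definition Mmul (z : Omega * Omega) : Omega := fun i => z.1 i && z.2 i.

Definition is_push_M (R : realType) (mu : probability Omega R)
    (lam : probability (Omega * Omega)%type R) : Prop :=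
  forall A : set Omega, measurable A -> mu A = lam (Mmul @^-1` A).

Definition mt_subordinate (R : realType) (X : set conf) (nu : probability Omega R) : Prop :=
  subshift X /\
  forall mu : probability Omega R,
    inv_on X mu <->
    exists lam : probability (Omega * Omega)%type R,
      shift_inv2 lam /\
      (forall A : set Omega, measurable A -> lam (fst @^-1` A) = nu A) /\
      is_push_M mu lam.

Definition log2 (R : realType) (x : R) : R := ln x / ln 2.

Definition cyl (n : nat) (w : {ffun 'I_n -> bool}) : set conf :=
  [set x | forall i : 'I_n, x (Posz (nat_of_ord i)) = w i].

Definition sym_prob (R : realType) (nu : probability Omega R) (a : bool) : R :=
  fine (nu ([set x : conf | x 0 = a] : set Omega)).

(* Kolmogorov-Sinai entropy (base 2), computed with the generating
   partition into 1-cylinders:  h(mu) = lim_n -(1/n) sum_{|w|=n} mu[w] log2 mu[w]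
   (with 0 log 0 = 0, since ln 0 = 0 in the library). *)
Definition entropy (R : realType) (mu : probability Omega R) : R :=
  limn (fun n : nat =>
    (n%:R)^-1 * - \sum_(w : {ffun 'I_n -> bool})
        (fine (mu (cyl w : set Omega)) * log2 (fine (mu (cyl w : set Omega))))).

Definition pot (R : realType) (phi : bool -> R) (x : conf) : R := phi (x 0).

Definition birkhoff (R : realType) (phi : bool -> R) (n : nat) (x : conf) : R :=
  \sum_(j < n) pot phi (iter j shift x).

Definition lang (X : set conf) (n : nat) (w : {ffun 'I_n -> bool}) : Prop :=
  exists2 x, X x & cyl w x.

Definition pressure (R : realType) (X : set conf) (phi : bool -> R) : R :=
  limn (fun n : nat =>
    (n%:R)^-1 * log2 (\sum_(w : {ffun 'I_n -> bool} | `[< lang X w >])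
        ((2 : R) `^ sup [set birkhoff phi n x | x in X `&` cyl w]))).

Definition free_energy (R : realType) (phi : bool -> R) (mu : probability Omega R) : R :=
  entropy mu + Rintegral mu setT (fun x : Omega => pot phi x).

Definition equilibrium (R : realType) (X : set conf) (phi : bool -> R)
    (mu : probability Omega R) : Prop :=
  inv_on X mu /\
  forall mu' : probability Omega R, inv_on X mu' -> free_energy phi mu' <= free_energy phi mu.

Definition bernoulli_seq (R : realType) (p : R) (beta : probability Omega R) : Prop :=
  forall (s : seq int) (w : int -> bool), uniq s ->
    beta ([set x : conf | forall i, i \in s -> x i = w i] : set Omega) =
    (\prod_(i <- s) (if w i then 1 - p else p))%:E.

Definition is_product (R : realType) (nu beta : probability Omega R)
    (lam : probability (Omega * Omega)%type R) : Prop :=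
  forall A B : set Omega, measurable A -> measurable B ->
    lam (A `*` B) = (nu A * beta B)%E.

(* Main.v *)
Require Import Defs.
From HB Require Import structures.
From mathcomp Require Import all_boot all_order all_algebra.
From mathcomp Require Import all_classical all_reals all_analysis.
From mathcomp Require Import ring lra zify.
(* Imported again so that [shift] is the shift map of [Defs]. *)
Import Defs.
Import Order.TTheory GRing.Theory Num.Theory.
Import numFieldNormedType.Exports.
Local Open Scope classical_set_scope.
Local Open Scope ring_scope.

(** Let [lam] be a joining with first marginal [nu] and [mu = M_* lam]; write [x]
    for the [nu]-coordinate and [z] for the product.  A site with [x_i = 0] forces
    [z_i = 0], so Gibbs' inequality, applied conditionally on an [n]-block of [x],
    gives [H_n(z | x) + E phi^(n) <= n F], where [F] is the claimed pressure.  Hence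
    [H_n(z) + E phi^(n) <= H_n(x) + n F], and [H_n(x) = o(n)], so no invariant
    measure on [X] has free energy above [F]; for [lam = nu (x) B_p] Gibbs'
    inequality is an equality and [F] is attained.

    Uniqueness: the gap [D_n >= 0] in the conditional Gibbs inequality is a
    conditional relative entropy with respect to a product kernel, hence
    superadditive in [n].  For an equilibrium state [D_n <= H_n(x) = o(n)], so
    [k D_m <= D_{km} = o(k)] forces [D_m = 0] for every [m], which determines all
    block probabilities of [mu].

    The pressure is at least [F] by Gibbs' inequality for the equilibrium state.
    For the converse, an ultrafilter limit of empirical measures spread over one
    point per [n]-cylinder is an invariant measure on [X]; comparing with a backward
    Markov kernel of memory [m] bounds the pressure by
    [H_{m+1} - H_m + E phi] for all [m] at once, and summing over [m] brings back
    the block inequality above. *)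

Set Implicit Arguments.
Unset Strict Implicit.
Unset Printing Implicit Defensive.

(** * Gibbs' inequality *)

Section Log2.
Variable R : realType.
Implicit Types x y : R.

Lemma ln2_gt0 : 0 < ln 2 :> R.
Proof. by apply: ln_gt0; lra. Qed.

Lemma log2M x y : 0 < x -> 0 < y -> log2 (x * y) = log2 x + log2 y.
Proof. by move=> x0 y0; rewrite /log2 lnM ?posrE// mulrDl. Qed.

Lemma log2V x : 0 < x -> log2 x^-1 = - log2 x.
Proof. by move=> x0; rewrite /log2 lnV ?posrE// mulNr. Qed.

Lemma log2_1 : log2 1 = 0 :> R.
Proof. by rewrite /log2 ln1 mul0r. Qed.

Lemma log2_powR x : log2 (2 `^ x) = x.
Proof. by rewrite /log2 ln_powR mulfK// gt_eqF// ln2_gt0. Qed.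

Lemma ler_log2 x y : 0 < x -> x <= y -> log2 x <= log2 y.
Proof.
move=> x0 xy; rewrite /log2 ler_pM2r ?invr_gt0 ?ln2_gt0// ler_ln ?posrE//.
exact: lt_le_trans xy.
Qed.

Lemma log2_le0 x : x <= 1 -> log2 x <= 0.
Proof.
move=> x1; rewrite /log2 pmulr_lle0 ?invr_gt0 ?ln2_gt0//.
exact: ln_le0.
Qed.

(** This is [ln (1 + t) <= t] at [t = y / x]. The error [y / ln 2] does not depend on [x], so a
    perturbation [y] inside the logarithm costs the same for every word. *)
Lemma log2D_le x y : 0 < x -> 0 <= y -> x * log2 (x + y) <= x * log2 x + y / ln 2.
Proof.
move=> x0 y0; rewrite /log2 !mulrA -mulrDl ler_pM2r ?invr_gt0 ?ln2_gt0//.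
have -> : x + y = x * (1 + y / x) by rewrite mulrDr mulr1 mulrC divfK// gt_eqF.
have h : 0 <= y / x by rewrite divr_ge0// ltW.
rewrite lnM ?posrE//; last by lra.
rewrite mulrDr lerD2l -[leRHS](mulrVK (x := x)) ?unitfE ?gt_eqF//.
rewrite [leRHS]mulrC ler_pM2l//; apply: le_ln1Dx; lra.
Qed.

(** This is [ln t <= t - 1] at [t = y / x], multiplied by [x]. For [x = 0] the left side vanishes by
    the convention [0 * log2 0 = 0]. *)
Lemma gibbs_term x y : 0 <= x -> 0 <= y -> (0 < x -> 0 < y) ->
  x * log2 y - x * log2 x <= (y - x) / ln 2.
Proof.
move=> x0 y0 xy; rewrite /log2 !mulrA -mulrBl ler_pM2r ?invr_gt0 ?ln2_gt0//.
move: x0; rewrite le_eqVlt => /predU1P[<-|x0]; first by rewrite !mul0r !subr0.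
have {}y0 := xy x0.
rewrite -mulrBr -ln_div ?posrE//.
have := @le_ln1Dx R (y / x - 1).
have : 0 < y / x by rewrite divr_gt0.
rewrite (addrC 1) subrK => h /(_ ltac:(lra)) le.
apply: (le_trans (ler_wpM2l (ltW x0) le)).
by rewrite mulrBr mulr1 mulrC divfK// gt_eqF.
Qed.

(** With [z = ln (y / x)] equality reads [1 + z = expR z], which strict convexity of the exponential
    allows only at [z = 0]. *)
Lemma gibbs_term_eq x y : 0 <= x -> 0 <= y -> (0 < x -> 0 < y) ->
  x * log2 y - x * log2 x = (y - x) / ln 2 -> x = y.
Proof.
have l2 := ln2_gt0.
move=> x0 y0 xy; rewrite /log2 !mulrA -mulrBl => /(mulIf (invr_neq0 (lt0r_neq0 l2))).
move: x0; rewrite le_eqVlt => /predU1P[<-|x0].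
  by rewrite !mul0r !subr0.
have {}y0 := xy x0.
rewrite -mulrBr -ln_div ?posrE// => e.
have yx0 : 0 < y / x by rewrite divr_gt0.
set z := ln (y / x).
have ez : expR z = y / x by rewrite lnK.
have e1 : 1 + z = expR z.
  rewrite ez; apply: (mulfI (x := x)); first by rewrite gt_eqF.
  by rewrite mulrDr mulr1 e mulrCA divff ?gt_eqF// mulr1; lra.
have [z0|z0] := eqVneq z 0.
  move: ez; rewrite z0 expR0 => e2.
  by apply/esym; rewrite -[RHS]mul1r e2 divfK// gt_eqF.
by have := expR_gt1Dx z0; rewrite -e1 ltxx.
Qed.

Section Gibbs.
Variables (I : eqType) (r : seq I) (P Q : I -> R).
Hypotheses (P0 : forall i, 0 <= P i) (Q0 : forall i, 0 <= Q i).
Hypothesis PQ : forall i, 0 < P i -> 0 < Q i.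
Hypothesis sumQP : \sum_(i <- r) Q i <= \sum_(i <- r) P i.

(** The termwise bounds add up to [(sum Q - sum P) / ln 2 <= 0]. Asking only for [sum Q <= sum P]
    lets [Q] be a subprobability. *)
Lemma gibbs :
  \sum_(i <- r) P i * log2 (Q i) <= \sum_(i <- r) P i * log2 (P i).
Proof.
rewrite -subr_le0 -sumrB.
apply: (@le_trans _ _ (\sum_(i <- r) (Q i - P i) / ln 2)).
  by apply: ler_sum => i _; apply: gibbs_term => //; exact: PQ.
by rewrite -mulr_suml pmulr_lle0 ?invr_gt0 ?ln2_gt0// sumrB subr_le0.
Qed.

Lemma gibbs_eq :
  \sum_(i <- r) P i * log2 (P i) <= \sum_(i <- r) P i * log2 (Q i) ->
  forall i, i \in r -> P i = Q i.
Proof.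
move=> le.
(* Each [d i] is the slack in [gibbs_term]; nonnegative slacks with a sum at most 0 all vanish. *)
pose d i := (Q i - P i) / ln 2 - (P i * log2 (Q i) - P i * log2 (P i)).
have d0 i : 0 <= d i.
  by rewrite subr_ge0; apply: gibbs_term => //; exact: PQ.
have : \sum_(i <- r) d i <= 0.
  rewrite /d sumrB -mulr_suml !sumrB subr_le0.
  apply: (@le_trans _ _ 0); last by rewrite subr_ge0.
  by rewrite pmulr_lle0 ?invr_gt0 ?ln2_gt0// subr_le0.
move=> s0 i ir; have : d i == 0.
  rewrite eq_le d0 andbT (le_trans _ s0)// (big_rem i)//= lerDl.
  by apply: sumr_ge0.
rewrite /d subr_eq0 => /eqP e; apply: gibbs_term_eq => //; exact: PQ.
Qed.

End Gibbs.
End Log2.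

(** * Block entropies of stationary laws *)

Section Words.
Variable S : finType.

(** Blocks are plain sequences rather than finite functions, so that splitting a block is [++],
    [take] and [drop]. *)
Fixpoint words n : seq (seq S) :=
  if n is n'.+1 then [seq a :: v | a <- index_enum S, v <- words n']
  else [:: [::]].

Lemma mem_words n v : (v \in words n) = (size v == n).
Proof.
elim: n v => [|n ih] [|a v] //=.
  by apply/negP => /allpairsP[[b w] [_ _]].
rewrite eqSS -ih; apply/allpairsP/idP => [[[b w] [_ /= h [_ ->]]]//|h].
by exists (a, v); split => //; exact: mem_index_enum.
Qed.

Lemma words_uniq n : uniq (words n).
Proof.
elim: n => //= n ih; apply: allpairs_uniq => //; first exact: index_enum_uniq.
by move=> [a v] [b w] _ _ /= [-> ->].
Qed.

Section Sums.
Variables (V : nmodType).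
Implicit Types F : seq S -> V.

Lemma sum_words0 F : \sum_(v <- words 0) F v = F [::].
Proof. by rewrite big_seq1. Qed.

Lemma sum_wordsS n F :
  \sum_(v <- words n.+1) F v = \sum_a \sum_(v <- words n) F (a :: v).
Proof. exact: big_allpairs_dep. Qed.

Lemma sum_words_cat m n F :
  \sum_(w <- words (m + n)) F w =
  \sum_(u <- words m) \sum_(v <- words n) F (u ++ v).
Proof.
elim: m F => [|m ih] F; first by rewrite sum_words0.
by rewrite addSn !sum_wordsS; apply: eq_bigr => a _; rewrite ih.
Qed.

End Sums.

End Words.

Lemma sum_words_map (S S' : finType) (f : S -> S') (V : nmodType) n
    (F : seq S -> V) :
  \sum_(w <- words S n) F w =
  \sum_(u <- words S' n) \sum_(w <- words S n | map f w == u) F w.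
Proof.
under [RHS]eq_bigr do rewrite big_mkcond.
rewrite exchange_big /=; apply: eq_big_seq => w.
rewrite mem_words => /eqP sw.
rewrite (bigD1_seq (map f w)) ?words_uniq ?mem_words ?size_map ?sw//= eqxx.
by rewrite big1 ?addr0// => u; rewrite eq_sym => /negbTE ->.
Qed.

(** * Fekete's subadditive lemma *)

Section Fekete.
Variable R : realType.

(** The limit is the infimum of [a n / n] over positive [n], which yields the lower bound
    [n * h <= a n] for every [n] as well. *)
Lemma fekete (a : nat -> R) : (forall n, 0 <= a n) ->
  (forall m n, a (m + n)%N <= a m + a n) ->
  exists2 h : R, (fun n => n%:R^-1 * a n) @ \oo --> h &
    forall n, n%:R * h <= a n.
Proof.
move=> a0 sub.
(* The term [a 0] stays because the assumptions do not force it to vanish. *)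
have mulle N q : a (q * N)%N <= q%:R * a N + a 0.
  elim: q => [|q ih]; first by rewrite mul0n mul0r add0r.
  rewrite mulSn; apply: (le_trans (sub _ _)).
  by rewrite -natr1 mulrDl mul1r; lra.
pose A := [set n%:R^-1 * a n | n in [set n | (0 < n)%N]].
have A1 : A (1%:R^-1 * a 1) by exists 1%N.
have lbA : lbound A 0.
  by move=> _ [n _ <-]; rewrite mulr_ge0// invr_ge0.
have infA : has_inf A by split; [exists (1%:R^-1 * a 1) | exists 0].
have lower n : (0 < n)%N -> inf A <= n%:R^-1 * a n.
  by move=> n0; apply: ge_inf; [exists 0|exists n].
exists (inf A); last first.
  case=> [|n]; first by rewrite mul0r.
  by rewrite mulrC -ler_pdivlMr ?ltr0n// mulrC; exact: lower.
apply/cvgrPdist_le => e e0.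
have [_ [N N0 <-] Ne] := @inf_adherent _ A (e / 2) ltac:(lra) infA.
(* [M] dominates [a 0] plus any remainder term [a (n %% N)], so the error is bounded independently
   of [n]. *)
pose M := a 0 + \sum_(r < N) a r.
have M0 : 0 <= M by rewrite addr_ge0// sumr_ge0.
near=> n.
have n0 : (0 < n)%N by near: n; exists 1%N.
have nR : 0 < n%:R :> R by rewrite ltr0n.
have := lower n n0.
suff : n%:R^-1 * a n <= inf A + e.
  by move=> h1 h2; rewrite distrC ger0_norm ?subr_ge0//; lra.
have an : a n <= (n %/ N)%:R * a N + M.
  rewrite {1}(divn_eq n N); apply: (le_trans (sub _ _)).
  rewrite addrA lerD//.
  have rN : (n %% N < N)%N by rewrite ltn_mod.
  rewrite (bigD1 (Ordinal rN))//= lerDl.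
  by apply: sumr_ge0.
have qN : (n %/ N)%:R * N%:R <= n%:R :> R.
  by rewrite -natrM ler_nat leq_divM.
have NR : 0 < N%:R :> R by rewrite ltr0n.
have aN : a N <= N%:R * (inf A + e / 2).
  by rewrite -ler_pdivrMl// ltW.
rewrite ler_pdivrMl//.
apply: (le_trans an).
have inf0 : 0 <= inf A by apply: lb_le_inf => //; exists (1%:R^-1 * a 1).
have : (n %/ N)%:R * a N <= n%:R * (inf A + e / 2).
  apply: (@le_trans _ _ ((n %/ N)%:R * (N%:R * (inf A + e / 2)))).
    by rewrite ler_wpM2l.
  by rewrite mulrA ler_wpM2r//; lra.
have : M <= n%:R * (e / 2).
  rewrite -ler_pdivrMr; last by lra.
  near: n; exact: nbhs_infty_ger.
rewrite !mulrDr; lra.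
Unshelve. all: by end_near.
Qed.

End Fekete.

(** * Stationary block laws and their entropies *)

Section StationaryLaw.
Variables (R : realType) (S : finType).

(** These are the conditions on the block probabilities of a stationary process: [law_rcons] is
    consistency of the marginals, and [law_cons] adds invariance under the shift. *)
Record statlaw (L : seq S -> R) : Prop := Statlaw {
  law_ge0 : forall v, 0 <= L v;
  law_nil : L [::] = 1;
  law_cons : forall v, \sum_a L (a :: v) = L v;
  law_rcons : forall v, \sum_a L (rcons v a) = L v }.

Definition block_entropy (L : seq S -> R) n : R :=
  - \sum_(v <- words S n) L v * log2 (L v).

Variables (L : seq S -> R) (HL : statlaw L).

Lemma law_catl n v : \sum_(u <- words S n) L (u ++ v) = L v.
Proof.
elim: n v => [|n ih] v; first by rewrite sum_words0.
rewrite sum_wordsS exchange_big /= -ih; apply: eq_bigr => u _.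
exact: (law_cons HL).
Qed.

Lemma law_catr n u : \sum_(v <- words S n) L (u ++ v) = L u.
Proof.
elim: n u => [|n ih] u; first by rewrite sum_words0 cats0.
rewrite sum_wordsS -(law_rcons HL); apply: eq_bigr => a _.
by rewrite -ih; apply: eq_bigr => v _; rewrite cat_rcons.
Qed.

Lemma law_total n : \sum_(v <- words S n) L v = 1.
Proof. by rewrite -(law_nil HL) -(law_catr n). Qed.

Lemma law_le_catl u v : L (u ++ v) <= L u.
Proof.
rewrite -(law_catr (size v) u) (bigD1_seq v) ?words_uniq ?mem_words//= lerDl.
by apply: sumr_ge0 => *; exact: law_ge0.
Qed.

Lemma law_le_catr u v : L (u ++ v) <= L v.
Proof.
rewrite -(law_catl (size u) v) (bigD1_seq u) ?words_uniq ?mem_words//= lerDl.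
by apply: sumr_ge0 => *; exact: law_ge0.
Qed.

Lemma law_le1 v : L v <= 1.
Proof. by rewrite -(law_nil HL) -{1}(cats0 v) law_le_catr. Qed.

Lemma block_entropy_ge0 n : 0 <= block_entropy L n.
Proof.
rewrite /block_entropy oppr_ge0; apply: sumr_le0 => v _.
by rewrite mulr_ge0_le0 ?law_ge0// log2_le0// law_le1.
Qed.

Lemma sum_law_catl m n (f : seq S -> R) :
  \sum_(w <- words S (m + n)) L w * f (take m w) =
  \sum_(u <- words S m) L u * f u.
Proof.
rewrite sum_words_cat; apply: eq_big_seq => u; rewrite mem_words => /eqP su.
rewrite -[in RHS](law_catr n u) mulr_suml; apply: eq_bigr => v _.
by rewrite take_size_cat.
Qed.

Lemma sum_law_catr m n (f : seq S -> R) :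
  \sum_(w <- words S (m + n)) L w * f (drop m w) =
  \sum_(v <- words S n) L v * f v.
Proof.
rewrite sum_words_cat exchange_big; apply: eq_bigr => v _.
rewrite -[in RHS](law_catl m v) mulr_suml; apply: eq_big_seq => u.
by rewrite mem_words => /eqP su; rewrite drop_size_cat.
Qed.

(** Gibbs' inequality against the law [Q] under which the two sub-blocks are independent. Where
    [L w] is positive both factors of [Q w] are too, so the logarithm splits. *)
Lemma block_entropy_subadd m n :
  block_entropy L (m + n) <= block_entropy L m + block_entropy L n.
Proof.
rewrite /block_entropy -opprD lerN2.
rewrite -(sum_law_catl m n (fun v => log2 (L v))).
rewrite -(sum_law_catr m n (fun v => log2 (L v))) -big_split /=.
pose Q w := L (take m w) * L (drop m w).
apply: (@le_trans _ _ (\sum_(w <- words S (m + n)) L w * log2 (Q w))).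
  apply: ler_sum => w _; rewrite -mulrDr /Q.
  have := law_ge0 HL w; rewrite le_eqVlt => /predU1P[<-|w0].
    by rewrite !mul0r.
  by rewrite log2M// (lt_le_trans w0)// -{1}(cat_take_drop m w)
    ?law_le_catl ?law_le_catr.
apply: gibbs.
- by move=> *; exact: law_ge0.
- by move=> *; rewrite mulr_ge0// law_ge0.
- by move=> w w0; rewrite mulr_gt0// (lt_le_trans w0)// -{1}(cat_take_drop m w)
    ?law_le_catl ?law_le_catr.
- rewrite law_total sum_words_cat -(law_total m).
  rewrite [leLHS]big_seq [leRHS]big_seq ler_sum// => u.
  rewrite mem_words => /eqP su.
  rewrite /Q; under eq_bigr do rewrite take_size_cat// drop_size_cat//.
  by rewrite -mulr_sumr law_total mulr1.
Qed.

Lemma block_entropy_cvg : exists2 h : R,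
  (fun n => n%:R^-1 * block_entropy L n) @ \oo --> h &
  forall n, n%:R * h <= block_entropy L n.
Proof.
by apply: fekete; [exact: block_entropy_ge0 | exact: block_entropy_subadd].
Qed.

(** By stationarity every letter of the block has law [L [:: a]]; the induction peels off the last
    one. *)
Lemma sum_law_additive n (g : S -> R) :
  \sum_(w <- words S n) L w * (\sum_(a <- w) g a) =
  n%:R * \sum_a L [:: a] * g a.
Proof.
elim: n => [|n ih]; first by rewrite sum_words0 big_nil mulr0 mul0r.
rewrite -addn1 natrD mulrDl mul1r -ih.
rewrite -(sum_law_catl n 1 (fun v => \sum_(a <- v) g a)).
have -> : \sum_a L [:: a] * g a = \sum_(w <- words S 1) L w * \sum_(a <- w) g a.
  by rewrite sum_wordsS; apply: eq_bigr => a _; rewrite sum_words0 big_seq1.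
rewrite -(sum_law_catr n 1 (fun v => \sum_(a <- v) g a)) -big_split /=.
apply: eq_bigr => w _.
by rewrite -mulrDr -big_cat cat_take_drop.
Qed.

End StationaryLaw.

(** * Masked processes *)

Lemma sum_fiber_fst_cons (V : nmodType) (S S' : finType) (a : S) (u : seq S)
    (F : seq (S * S') -> V) n :
  \sum_(w <- words (S * S')%type n.+1 | map fst w == a :: u) F w =
  \sum_b \sum_(w <- words (S * S')%type n | map fst w == u) F ((a, b) :: w).
Proof.
pose G a' b := \sum_(w <- words (S * S')%type n)
  if map fst ((a', b) :: w) == a :: u then F ((a', b) :: w) else 0.
rewrite big_mkcond sum_wordsS (eq_bigr (fun s => G s.1 s.2)); last by case.
rewrite -(pair_bigA _ G) /=.
rewrite (bigD1 a)//= [X in _ + X]big1 ?addr0.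
  apply: eq_bigr => b _; rewrite [RHS]big_mkcond.
  by apply: eq_bigr => w _; rewrite eqseq_cons eqxx.
move=> a' /negbTE aa'; apply: big1 => b _; apply: big1 => w _.
by rewrite eqseq_cons aa'.
Qed.

Lemma sum_fiber_fst_snd (V : nmodType) (S S' : finType) (u : seq S)
    (G : seq S' -> V) :
  \sum_(w <- words (S * S')%type (size u) | map fst w == u) G (map snd w) =
  \sum_(z <- words S' (size u)) G z.
Proof.
elim: u G => [|a u ih] G /=; first by rewrite big_mkcond !big_seq1.
rewrite sum_fiber_fst_cons big_allpairs_dep; apply: eq_bigr => b _ /=.
exact: (ih (fun z => G (b :: z))).
Qed.

Lemma sum_words_pair (R : comNzSemiRingType) (S S' : finType) n (F : seq S -> R)
    (G : seq S' -> R) :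
  \sum_(w <- words (S * S')%type n) F (map fst w) * G (map snd w) =
  (\sum_(u <- words S n) F u) * (\sum_(z <- words S' n) G z).
Proof.
rewrite (sum_words_map fst) mulr_suml; apply: eq_big_seq => u.
rewrite mem_words => /eqP su.
rewrite -su -(sum_fiber_fst_snd u) mulr_sumr.
by apply: eq_bigr => w /eqP ->.
Qed.

(** * Conditional entropy of a masked process relative to the Bernoulli kernel *)

Section MaskedLaw.
Variables (R : realType) (p : R).
Hypotheses (p0 : 0 < p) (p1 : p < 1).

(** For [s = (x, z)] with [z = x * y] and [y] equal to 0 with probability [p], this is the
    conditional probability of [z] given [x]; a site with [x = 0] forces [z = 0]. *)
Definition mask_kernel (s : bool * bool) : R :=
  if s.1 then (if s.2 then 1 - p else p) else (if s.2 then 0 else 1).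

Definition mask_prod (w : seq (bool * bool)) : R := \prod_(s <- w) mask_kernel s.

Let below (w : seq (bool * bool)) := all (fun s => s.2 ==> s.1) w.

Lemma mask_kernel_ge0 s : 0 <= mask_kernel s.
Proof. by case: s => [[] []]; rewrite /mask_kernel //= ?subr_ge0 ltW. Qed.

Lemma mask_kernel_gt0 (s : bool * bool) : s.2 ==> s.1 -> 0 < mask_kernel s.
Proof. by case: s => [[] []]; rewrite /mask_kernel //= ?subr_gt0. Qed.

Lemma mask_prod_ge0 w : 0 <= mask_prod w.
Proof. by apply: prodr_ge0 => s _; exact: mask_kernel_ge0. Qed.

Lemma mask_prod_gt0 w : below w -> 0 < mask_prod w.
Proof.
move=> /allP h; rewrite /mask_prod big_seq; apply: prodr_gt0 => s sw.
by apply: mask_kernel_gt0; exact: h.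
Qed.

Lemma log2_mask_prod w : below w ->
  log2 (mask_prod w) = \sum_(s <- w) log2 (mask_kernel s).
Proof.
rewrite /mask_prod; elim: w => [|s w ih] /=; first by rewrite !big_nil log2_1.
move=> /andP[h /[dup] hw /ih {}ih]; rewrite !big_cons log2M ?ih//.
  exact: mask_kernel_gt0.
exact: mask_prod_gt0.
Qed.

Lemma sum_mask_prod u :
  \sum_(w <- words (bool * bool)%type (size u) | map fst w == u) mask_prod w = 1.
Proof.
elim: u => [|a u ih] /=.
  by rewrite big_mkcond big_seq1 /= /mask_prod big_nil.
rewrite sum_fiber_fst_cons.
under eq_bigr => b _.
  under eq_bigr do rewrite /mask_prod big_cons.
  rewrite -mulr_sumr -/(mask_prod _) ih mulr1; over.
by case: a; rewrite big_bool /mask_kernel /=; lra.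
Qed.

(** [N] is the law of the base [x], [M] that of the product [z], and [L] that of the pair. [suppL]
    says that [z_i = 1] only where [x_i = 1]. *)
Variables (N M : seq bool -> R) (L : seq (bool * bool) -> R).
Hypotheses (HN : statlaw N) (HM : statlaw M) (HL : statlaw L).
Hypothesis margN : forall u,
  \sum_(w <- words (bool * bool)%type (size u) | map fst w == u) L w = N u.
Hypothesis margM : forall z,
  \sum_(w <- words (bool * bool)%type (size z) | map snd w == z) L w = M z.
Hypothesis suppL : forall w, ~~ below w -> L w = 0.

Let W n := words (bool * bool)%type n.

Lemma law_le_fst w : L w <= N (map fst w).
Proof.
rewrite -margN size_map (big_rem w) ?mem_words//= eqxx lerDl.
by apply: sumr_ge0 => *; exact: law_ge0.
Qed.

Lemma law_le_snd w : L w <= M (map snd w).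
Proof.
rewrite -margM size_map (big_rem w) ?mem_words//= eqxx lerDl.
by apply: sumr_ge0 => *; exact: law_ge0.
Qed.

Lemma below_law w : 0 < L w -> below w.
Proof. by move=> w0; apply: contraTT w0 => /suppL ->; rewrite ltxx. Qed.

Lemma sum_law_fst n (f : seq bool -> R) :
  \sum_(w <- W n) L w * f (map fst w) = \sum_(u <- words bool n) N u * f u.
Proof.
rewrite (sum_words_map fst); apply: eq_big_seq => u.
rewrite mem_words => /eqP su; rewrite -margN su mulr_suml.
by apply: eq_bigr => w /eqP ->.
Qed.

Lemma sum_law_snd n (f : seq bool -> R) :
  \sum_(w <- W n) L w * f (map snd w) = \sum_(u <- words bool n) M u * f u.
Proof.
rewrite (sum_words_map snd); apply: eq_big_seq => u.
rewrite mem_words => /eqP su; rewrite -margM su mulr_suml.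
by apply: eq_bigr => w /eqP ->.
Qed.

(** The mean log-likelihood of one site under the kernel. For the Gibbs value of [p], its negative
    is the claimed pressure minus the mean potential. *)
Definition mask_energy := \sum_s L [:: s] * log2 (mask_kernel s).

(* The conditional relative entropy of the second coordinate given the first,
   with respect to the product kernel [mask_prod]. *)
Definition mask_defect n : R :=
  \sum_(w <- W n) L w * log2 (L w)
  - \sum_(w <- W n) L w * log2 (N (map fst w) * mask_prod w).

(** Where [L w] is positive the logarithm splits into that of [N] and a sum over letters, and
    stationarity turns the latter into [n * mask_energy]. *)
Lemma mask_defectE n : mask_defect n =
  block_entropy N n - block_entropy L n - n%:R * mask_energy.
Proof.
suff : \sum_(w <- W n) L w * log2 (N (map fst w) * mask_prod w) =
    - block_entropy N n + n%:R * mask_energy.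
  by rewrite /mask_defect => ->; rewrite [block_entropy L n]/block_entropy; lra.
rewrite /mask_energy -(sum_law_additive HL n (fun s => log2 (mask_kernel s))).
rewrite /block_entropy opprK -(sum_law_fst n (fun u => log2 (N u))).
rewrite -big_split/=; apply: eq_bigr => w _.
have := law_ge0 HL w; rewrite le_eqVlt => /predU1P[<-|w0].
  by rewrite !mul0r addr0.
have bw := below_law w0.
rewrite log2M ?mask_prod_gt0//; last exact: lt_le_trans (law_le_fst w).
by rewrite log2_mask_prod// mulrDr.
Qed.

Lemma sum_fst_mask_prod n : \sum_(w <- W n) N (map fst w) * mask_prod w = 1.
Proof.
rewrite -(law_total HN n) (sum_words_map fst); apply: eq_big_seq => u.
rewrite mem_words => /eqP su.
rewrite -[RHS]mulr1 -(sum_mask_prod u) su mulr_sumr.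
by apply: eq_bigr => w /eqP ->.
Qed.

Lemma mask_defect_ge0 n : 0 <= mask_defect n.
Proof.
rewrite subr_ge0; apply: gibbs.
- by move=> w; exact: law_ge0.
- by move=> w; rewrite mulr_ge0 ?(law_ge0 HN) ?mask_prod_ge0.
- move=> w w0; rewrite mulr_gt0 ?mask_prod_gt0 ?below_law//.
  exact: lt_le_trans (law_le_fst w).
- by rewrite sum_fst_mask_prod law_total.
Qed.

Lemma mask_defect_eq0 n : mask_defect n <= 0 ->
  forall w, size w = n -> L w = N (map fst w) * mask_prod w.
Proof.
rewrite subr_le0 => h w sw; apply: (gibbs_eq _ _ _ _ h); rewrite ?mem_words ?sw//.
- by move=> v; exact: law_ge0.
- by move=> v; rewrite mulr_ge0 ?(law_ge0 HN) ?mask_prod_ge0.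
- move=> v w0; rewrite mulr_gt0 ?mask_prod_gt0 ?below_law//.
  exact: lt_le_trans (law_le_fst v).
- by rewrite sum_fst_mask_prod law_total.
Qed.

(* Subadditivity of conditional entropy: compare [L] with the measure under
   which, given the first coordinates, the two blocks are independent. *)
Lemma mask_defect_superadd m n :
  mask_defect m + mask_defect n <= mask_defect (m + n).
Proof.
rewrite !mask_defectE natrD.
(* The energy is linear in the length and cancels; what remains is subadditivity of conditional
   entropy. *)
suff : block_entropy N m - block_entropy L m
     + (block_entropy N n - block_entropy L n)
     <= block_entropy N (m + n) - block_entropy L (m + n) by lra.
(* [k w] is the conditional probability of [w] given its first track, with value 0 when that track
   is null. *)
pose k w := L w / N (map fst w).
have k0 w : 0 <= k w by rewrite mulr_ge0 ?invr_ge0 ?law_ge0.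
pose Q w := N (map fst w) * (k (take m w) * k (drop m w)).
have tk w : 0 < L w -> 0 < L (take m w).
  by move=> w0; apply: (lt_le_trans w0); rewrite -{1}(cat_take_drop m w) law_le_catl.
have dr w : 0 < L w -> 0 < L (drop m w).
  by move=> w0; apply: (lt_le_trans w0); rewrite -{1}(cat_take_drop m w) law_le_catr.
have fs w : 0 < L w -> 0 < N (map fst w).
  by move=> w0; exact: lt_le_trans (law_le_fst w).
have kpos w : 0 < L w -> 0 < k w by move=> w0; rewrite divr_gt0 ?fs.
(* Only [<= 1], since the sum is 0 over a null first track. *)
have ksum u : \sum_(w <- W (size u) | map fst w == u) k w <= 1.
  rewrite (eq_bigr (fun w => L w / N u)); last by move=> w /eqP <-.
  rewrite -mulr_suml margN.
  have [->|nz] := eqVneq (N u) 0; first by rewrite mul0r.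
  by rewrite divff.
have logk w : 0 < L w -> log2 (k w) = log2 (L w) - log2 (N (map fst w)).
  by move=> w0; rewrite log2M ?invr_gt0 ?fs// log2V ?fs.
have g : \sum_(w <- W (m + n)) L w * log2 (Q w)
      <= \sum_(w <- W (m + n)) L w * log2 (L w).
  apply: gibbs.
  - by move=> w; exact: law_ge0.
  - by move=> w; rewrite mulr_ge0 ?(law_ge0 HN)// mulr_ge0.
  - by move=> w w0; rewrite mulr_gt0 ?fs// mulr_gt0 ?kpos ?tk ?dr.
  (* [Q] has mass at most 1: the second track of each sub-block is summed out by [ksum], and the
     first tracks are then summed against [N]. *)
  - rewrite (law_total HL) -(law_total HN (m + n)) !sum_words_cat.
    rewrite (sum_words_map fst) [leLHS]big_seq [leRHS]big_seq.
    apply: ler_sum => u; rewrite mem_words => /eqP su.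
    apply: (@le_trans _ _ (\sum_(w <- W m | map fst w == u)
        k w * \sum_(v <- words bool n) N (u ++ v))).
      rewrite [leLHS]big_seq_cond [leRHS]big_seq_cond; apply: ler_sum => w.
      rewrite mem_words => /andP[/eqP sw /eqP wu].
      rewrite (sum_words_map fst) mulr_sumr [leLHS]big_seq [leRHS]big_seq.
      apply: ler_sum => v; rewrite mem_words => /eqP sv.
      rewrite (eq_bigr (fun w' => k w * N (u ++ v) * k w')); last first.
        move=> w' /eqP w'v.
        by rewrite /Q map_cat wu w'v take_size_cat// drop_size_cat//; ring.
      rewrite -mulr_sumr -sv; apply: ler_piMr; last exact: ksum.
      by rewrite mulr_ge0 ?(law_ge0 HN).
    rewrite -mulr_suml -su; apply: ler_piMl; last exact: ksum.
    by apply: sumr_ge0 => v _; exact: law_ge0.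
have e : \sum_(w <- W (m + n)) L w * log2 (Q w) = - block_entropy N (m + n)
   + (block_entropy N m - block_entropy L m)
   + (block_entropy N n - block_entropy L n).
  rewrite /block_entropy !opprK.
  rewrite -(sum_law_fst (m + n) (fun u => log2 (N u))).
  rewrite -(sum_law_fst m (fun u => log2 (N u))).
  rewrite -(sum_law_fst n (fun u => log2 (N u))).
  rewrite -(sum_law_catl HL m n (fun w => log2 (N (map fst w)))).
  rewrite -(sum_law_catl HL m n (fun w => log2 (L w))).
  rewrite -(sum_law_catr HL m n (fun w => log2 (N (map fst w)))).
  rewrite -(sum_law_catr HL m n (fun w => log2 (L w))).
  rewrite -!sumrN -!big_split/=; apply: eq_bigr => w _.
  have := law_ge0 HL w; rewrite le_eqVlt => /predU1P[<-|w0].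
    by rewrite !mul0r !oppr0 !addr0.
  have kt := kpos _ (tk _ w0); have kd := kpos _ (dr _ w0).
  rewrite /Q (log2M (fs _ w0) (mulr_gt0 kt kd)) (log2M kt kd).
  by rewrite !logk ?tk ?dr//; ring.
have eL : \sum_(w <- W (m + n)) L w * log2 (L w) = - block_entropy L (m + n).
  by rewrite opprK.
move: g; rewrite e eL; lra.
Qed.

Lemma mask_defect_mul k m : k%:R * mask_defect m <= mask_defect (k * m).
Proof.
elim: k => [|k ih]; first by rewrite mul0r mask_defect_ge0.
rewrite mulSn -natr1 mulrDl mul1r addrC.
by apply: le_trans (mask_defect_superadd _ _); rewrite lerD2l.
Qed.

(** Forgetting the first track can only raise a probability, [L w <= M (map snd w)], and [log2] is
    monotone. *)
Lemma block_entropy_snd_le n : block_entropy M n <= block_entropy L n.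
Proof.
rewrite lerN2 -(sum_law_snd n (fun u => log2 (M u))); apply: ler_sum => w _.
have := law_ge0 HL w; rewrite le_eqVlt => /predU1P[<-|w0].
  by rewrite !mul0r.
by rewrite ler_pM2l// ler_log2// law_le_snd.
Qed.

(** Gibbs' inequality against the product of the two marginals. *)
Lemma block_entropy_pair_le n :
  block_entropy L n <= block_entropy N n + block_entropy M n.
Proof.
rewrite /block_entropy -opprD lerN2 -(sum_law_snd n (fun u => log2 (M u))).
rewrite -(sum_law_fst n (fun u => log2 (N u))) -big_split/=.
apply: (@le_trans _ _ (\sum_(w <- W n)
    L w * log2 (N (map fst w) * M (map snd w)))).
  apply: ler_sum => w _.
  have := law_ge0 HL w; rewrite le_eqVlt => /predU1P[<-|w0].
    by rewrite !mul0r addr0.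
  by rewrite -mulrDr log2M// (lt_le_trans w0)// ?law_le_fst ?law_le_snd.
apply: gibbs.
- by move=> w; exact: law_ge0.
- by move=> w; rewrite mulr_ge0 ?law_ge0.
- by move=> w w0; rewrite mulr_gt0// (lt_le_trans w0)// ?law_le_fst ?law_le_snd.
- by rewrite sum_words_pair !law_total// mulr1.
Qed.

(** Nonnegativity of the defect together with [H(z) <= H(x, z)]; the upper bounds on free energy and
    on pressure both rest on this inequality. *)
Lemma block_entropy_mask_le n :
  block_entropy M n <= block_entropy N n - n%:R * mask_energy.
Proof.
have := mask_defect_ge0 n; rewrite mask_defectE.
have := block_entropy_snd_le n; lra.
Qed.

(** The defect vanishes, so [H(x, z) = H(x) - n * mask_energy]. Then [H(x, z) <= H(x) + H(z)]
    cancels [H(x)] exactly and leaves no error term. *)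
Lemma block_entropy_mask_ge n :
  (forall w, L w = N (map fst w) * mask_prod w) ->
  - (n%:R * mask_energy) <= block_entropy M n.
Proof.
move=> LE; have : mask_defect n = 0.
  by apply/eqP; rewrite subr_eq0; apply/eqP/eq_bigr => w _; rewrite -LE.
rewrite mask_defectE; have := block_entropy_pair_le n; lra.
Qed.

(** The lower bound on [H(z)] gives [k * D_m <= D_(k m) <= H_(k m)(x)], which is [o(k)]. Hence
    [D_m = 0], and the equality case of Gibbs' inequality identifies [L]. *)
Lemma masked_law_unique :
  (fun n => n%:R^-1 * block_entropy N n) @ \oo --> (0 : R) ->
  (forall n, - (n%:R * mask_energy) <= block_entropy M n) ->
  forall w, L w = N (map fst w) * mask_prod w.
Proof.
move=> N0 Mge w; apply: (mask_defect_eq0 (n := size w)) => //.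
have bound k : k%:R * mask_defect (size w) <= block_entropy N (k * size w).
  apply: (le_trans (mask_defect_mul _ _)); rewrite mask_defectE.
  have := Mge (k * size w)%N; have := block_entropy_snd_le (k * size w); lra.
(* The empty word is separate because the estimate below divides by [size w]. *)
have [w0|w0] := posnP (size w).
  have := bound 1%N; rewrite mul1r mul1n w0 => h; apply: (le_trans h).
  by rewrite /block_entropy sum_words0 (law_nil HN) log2_1 mulr0 oppr0.
have wR : 0 < (size w)%:R :> R by rewrite ltr0n.
apply/ler_addgt0Pr => e e0; rewrite add0r.
(* At length [k * size w] this tolerance becomes [k * e], and the positive factor [k] cancels. *)
have /cvgrPdist_le/(_ (e / (size w)%:R)) := N0.
case=> [|n0 _ h]; first by rewrite divr_gt0.
set k := n0.+1.
have kR : 0 < k%:R :> R by rewrite ltr0n.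
have := h (k * size w)%N; rewrite /= sub0r normrN.
have kw : (n0 <= k * size w)%N by rewrite (leq_trans (leqnSn n0))// leq_pmulr.
move=> /(_ kw); rewrite ger0_norm; last first.
  by rewrite mulr_ge0 ?invr_ge0 ?block_entropy_ge0.
rewrite ler_pdivrMl ?ltr0n ?muln_gt0// natrM -mulrA [_ * (e / _)]mulrC divfK ?gt_eqF//.
move=> h2; have := le_trans (bound k) h2.
by rewrite ler_pM2l.
Qed.

End MaskedLaw.

(** * Laws of finite-valued processes *)

Section Itinerary.
Variables (T S : Type) (tau : T -> T) (f : T -> S).

Fixpoint itin n t := if n is n'.+1 then f t :: itin n' (tau t) else [::].

Lemma size_itin n t : size (itin n t) = n.
Proof. by elim: n t => //= n ih t; rewrite ih. Qed.

Lemma itin_cat m n t : itin (m + n) t = itin m t ++ itin n (iter m tau t).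
Proof. by elim: m t => //= m ih t; rewrite ih -iterSr. Qed.

Lemma itinSr n t : itin n.+1 t = rcons (itin n t) (f (iter n tau t)).
Proof. by rewrite -addn1 itin_cat cats1. Qed.

Lemma nth_itin s0 n t i : (i < n)%N -> nth s0 (itin n t) i = f (iter i tau t).
Proof. by elim: n i t => // n ih [|i] t //= /ih ->; rewrite -iterSr. Qed.

End Itinerary.

Section FinitePartition.
Context d (T : measurableType d) (R : realType) (mu : probability T R).

Lemma fine_probabilityU (A B : set T) : measurable A -> measurable B ->
  A `&` B = set0 -> fine (mu (A `|` B)) = fine (mu A) + fine (mu B).
Proof. by move=> mA mB AB; rewrite measureU// fineD// fin_num_measure. Qed.

Lemma fine_probability_partition (I : eqType) (r : seq I) (g : T -> I)
    (B : set T) : uniq r -> (forall t, B t -> g t \in r) -> measurable B ->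
  (forall i, measurable [set t | g t = i]) ->
  fine (mu B) = \sum_(i <- r) fine (mu (B `&` [set t | g t = i])).
Proof.
move=> + + + mg; elim: r B => [|i r ih] B.
  move=> _ B0 _; have -> : B = set0 by rewrite -subset0 => t /B0.
  by rewrite big_nil measure0.
move=> /= /andP[ir ur] Br mB; rewrite big_cons.
rewrite -[in LHS](setDUK (A := B `&` [set t | g t = i]) (B := B))//.
have mD : measurable (B `\` (B `&` [set t | g t = i])).
  by apply: measurableD => //; exact: measurableI.
rewrite fine_probabilityU//; [|exact: measurableI|]; last first.
  by rewrite setDE setICA setICr setI0.
congr (_ + _); rewrite (ih (B `\` (B `&` [set t | g t = i])))//.
  apply: eq_big_seq => j jr; congr (fine (mu _)).
  apply/seteqP; split=> t /= [].
    by move=> [Bt _] gt.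
  move=> Bt gt; split=> //; split=> // -[_ gi].
  by move: ir; rewrite -gi gt jr.
move=> t [Bt] nB; have := Br t Bt; rewrite inE => /predU1P[gi|//].
by exfalso; apply: nB.
Qed.

End FinitePartition.

Section SystemLaw.
Context d (T : measurableType d) (R : realType) (mu : probability T R).
Variable tau : T -> T.
Hypothesis mtau : forall A, measurable A -> measurable (tau @^-1` A).
Hypothesis inv : forall A, measurable A -> mu (tau @^-1` A) = mu A.

Section Law.
Variables (S : finType) (f : T -> S).
Hypothesis mf : forall a, measurable [set t | f t = a].

Definition sys_law v := fine (mu [set t | itin tau f (size v) t = v]).

Lemma measurable_itin n v : measurable [set t | itin tau f n t = v].
Proof.
elim: n v => [|n ih] [|a v] /=.
- by rewrite (_ : [set _ | _] = setT) //; apply/seteqP; split.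
- by rewrite (_ : [set _ | _] = set0) //; apply/seteqP; split.
- by rewrite (_ : [set _ | _] = set0) //; apply/seteqP; split.
- rewrite (_ : [set _ | _] =
    [set t | f t = a] `&` tau @^-1` [set t | itin tau f n t = v]).
    by apply: measurableI; [exact: mf|apply: mtau; exact: ih].
  by apply/seteqP; split => t /= [-> ->].
Qed.

(** Prepending a letter splits the event pulled back by [tau], hence uses invariance; appending one
    splits by the symbol read at time [size v]. *)
Lemma sys_law_statlaw : statlaw sys_law.
Proof.
split.
- by move=> v; rewrite /sys_law fine_ge0.
- rewrite /sys_law /= (_ : [set _ | _] = setT) ?probability_setT//.
  by apply/seteqP; split.
- move=> v; rewrite /sys_law -(inv (measurable_itin _ _)).
  rewrite (@fine_probability_partition _ _ _ mu _ (index_enum S) f) //.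
  + apply: eq_bigr => a _; congr (fine (mu _)) => /=.
    by apply/seteqP; split => t /= [-> ->].
  + exact: index_enum_uniq.
  + by apply: mtau; exact: measurable_itin.
- move=> v; rewrite /sys_law.
  rewrite (@fine_probability_partition _ _ _ mu _ (index_enum S)
    (fun t => f (iter (size v) tau t)) [set t | itin tau f (size v) t = v]) //.
  + apply: eq_bigr => a _; congr (fine (mu _)); rewrite size_rcons.
    apply/seteqP; split => t; rewrite /mkset itinSr; last by move=> [-> ->].
    by move=> /rcons_inj[e1 e2]; split.
  + exact: index_enum_uniq.
  + exact: measurable_itin.
  + move=> a; elim: (size v) a => [|n ih] a //=.
    under eq_set do rewrite -iterS iterSr.
    by apply: (mtau (A := [set t | f (iter n tau t) = a])).
Qed.

End Law.

Lemma itin_map (S S' : Type) (h : S -> S') (f : T -> S) n t :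
  itin tau (h \o f) n t = map h (itin tau f n t).
Proof. by elim: n t => //= n ih t; rewrite ih. Qed.

Lemma sys_law_map (S S' : finType) (h : S -> S') (f : T -> S) u :
  (forall a, measurable [set t | f t = a]) ->
  \sum_(w <- words S (size u) | map h w == u) sys_law f w =
  sys_law (h \o f) u.
Proof.
move=> mf; rewrite {2}/sys_law.
have mhf a : measurable [set t | (h \o f) t = a].
  rewrite (_ : [set _ | _] = \bigcup_(b in [set b | h b = a]) [set t | f t = b]).
    by apply: fin_bigcup_measurable.
  by apply/seteqP; split => [t /= <-|t [b /= <- <-]]; first by exists (f t).
rewrite (@fine_probability_partition _ _ _ mu _ (words S (size u))
  (itin tau f (size u))).
- rewrite big_mkcond; apply: eq_big_seq => w; rewrite mem_words => /eqP sw.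
  case: eqP => hw.
    rewrite /sys_law sw; congr (fine (mu _)).
    apply/seteqP; split => t /=; last by case.
    by move=> e; rewrite itin_map e.
  rewrite (_ : _ `&` _ = set0) ?measure0//.
  by apply/seteqP; split => t //= [] + e; rewrite itin_map e.
- exact: words_uniq.
- by move=> t _; rewrite mem_words size_itin.
- exact: measurable_itin.
- by move=> w; exact: measurable_itin.
Qed.

End SystemLaw.

(** Links the cylinders indexed by finite functions in [entropy] and [pressure] with sums over
    words. *)
Lemma sum_ffun_words (S : finType) (V : nmodType) n (F : seq S -> V) :
  \sum_(w : {ffun 'I_n -> S}) F (codom w) = \sum_(v <- words S n) F v.
Proof.
rewrite -(big_map (fun w : {ffun 'I_n -> S} => codom w) predT F).
apply: perm_big; apply: uniq_perm; rewrite ?words_uniq//.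
  rewrite map_inj_uniq ?index_enum_uniq// => w1 w2 /eq_in_map e.
  by apply/ffunP => i; apply: e; rewrite mem_enum.
move=> v; rewrite mem_words; apply/mapP/eqP => [[w _ ->]|sv].
  by rewrite size_map size_enum_ord.
(* A nonempty [v] supplies the default letter of [nth]; at length zero the index type is empty. *)
case: v sv => [|a v] sv.
  have w0 : 'I_n -> S by move=> [i]; rewrite -sv.
  exists (finfun w0); first exact: mem_index_enum.
  by apply/esym/nilP; rewrite /nilp size_map size_enum_ord -sv.
exists [ffun i : 'I_n => nth a (a :: v) i]; first exact: mem_index_enum.
apply: (@eq_from_nth _ a); first by rewrite size_map size_enum_ord.
rewrite sv => i ni; rewrite (nth_map (Ordinal ni)) ?size_enum_ord// ffunE.
by rewrite nth_enum_ord.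
Qed.

(** * Measures on the two-sided shift *)

Section OmegaMeasurability.

Lemma measurable_coord (i : int) (b : bool) :
  measurable ([set x | x i = b] : set Omega).
Proof. by apply: sub_sigma_algebra; exists i, b. Qed.

Lemma measurable_to_Omega d (T : measurableType d) (F : T -> Omega) :
  (forall i b, measurable [set t | F t i = b]) -> measurable_fun setT F.
Proof.
move=> mF; apply: (@measurability _ _ _ _ setT F cylgen) => // _ [_ [i [b ->]] <-].
by rewrite setTI; exact: mF.
Qed.

Lemma measurable_shift (A : set Omega) : measurable A ->
  measurable (shift @^-1` A : set Omega).
Proof.
move=> mA; rewrite -[X in measurable X]setTI.
apply: (measurable_to_Omega (F := shift : Omega -> Omega)) => // i b.
exact: measurable_coord.
Qed.

Lemma iter_shiftE k (x : conf) (i : int) : iter k shift x i = x (i + k%:Z).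
Proof.
elim: k i => [|k ih] i /=; first by rewrite addr0.
by rewrite /shift ih -addrA -PoszD add1n.
Qed.

Lemma shift_inv_iter (R : realType) (mu : probability Omega R) k (A : set Omega) :
  shift_inv mu -> measurable A ->
  measurable (iter k shift @^-1` A : set Omega) /\
  mu (iter k shift @^-1` A : set Omega) = mu A.
Proof.
move=> inv mA; elim: k => [//|k [mk ek]].
have -> : iter k.+1 shift @^-1` A = shift @^-1` (iter k shift @^-1` A).
  by apply/seteqP; split => x /=; rewrite -iterS iterSr.
by split; [exact: measurable_shift | rewrite inv].
Qed.

End OmegaMeasurability.

(** * Blocks, centred windows and uniqueness of measures *)

Section Windows.

Definition block (j : int) n (x : conf) := [seq x (j + i%:Z) | i <- iota 0 n].

Lemma size_block j n x : size (block j n x) = n.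
Proof. by rewrite size_map size_iota. Qed.

Lemma block_shift j n x : block j n (shift x) = block (j + 1) n x.
Proof. by apply: eq_map => i; rewrite /shift addrAC. Qed.

Lemma block_cat j m n x : block j (m + n) x = block j m x ++ block (j + m%:Z) n x.
Proof.
rewrite /block iotaD map_cat add0n; congr (_ ++ _).
rewrite -[X in iota X _]addn0 iotaDl -map_comp; apply: eq_map => i /=.
by rewrite PoszD addrA.
Qed.

Lemma block_cons j n x : block j n.+1 x = x j :: block (j + 1) n x.
Proof. by rewrite -add1n block_cat /= addr0. Qed.

Lemma block_rcons j n x : block j n.+1 x = rcons (block j n x) (x (j + n%:Z)).
Proof. by rewrite -addn1 block_cat /block /= addr0 cats1. Qed.

Lemma itin_block n x : itin shift (fun y : conf => y 0) n x = block 0 n x.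
Proof.
suff h j : itin shift (fun y : conf => y 0) n (iter j shift x) = block j%:Z n x.
  exact: (h 0%N).
elim: n j => //= n ih j.
by rewrite block_cons iter_shiftE add0r -iterS ih -PoszD addn1.
Qed.

Lemma block_iter_shift j k n x :
  block j n (iter k shift x) = block (j + k%:Z) n x.
Proof. by apply: eq_map => i; rewrite iter_shiftE addrAC. Qed.

(** A word of even length grows on the right, one of odd length on the left. *)
Definition ext (v : seq bool) b := if odd (size v) then b :: v else rcons v b.

Lemma size_ext v b : size (ext v b) = (size v).+1.
Proof. by rewrite /ext; case: ifP; rewrite ?size_rcons. Qed.

Lemma ext_inj v w b c : size v = size w -> ext v b = ext w c -> v = w /\ b = c.
Proof.
rewrite /ext => ->; case: ifP => _; first by case.
by move=> /rcons_inj[-> ->].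
Qed.

Lemma extP w : (0 < size w)%N -> exists v b, w = ext v b.
Proof.
case: w => // b w _; have [od|od] := boolP (odd (size w)).
  by exists w, b; rewrite /ext od.
case/lastP: w od => [|w c] od; first by exists [::], b.
exists (b :: w), c; rewrite /ext /=.
by move: od; rewrite size_rcons /= negbK => ->.
Qed.

(** The site added at step [n]; the enumeration of Z is 0, -1, 1, -2, 2, and so on. *)
Definition coord n : int := if odd n then Negz n./2 else Posz n./2.

Lemma coord_surj i : exists n, coord n = i.
Proof.
case: i => k; first by exists k.*2; rewrite /coord odd_double doubleK.
by exists k.*2.+1; rewrite /coord /= odd_double /= uphalf_double.
Qed.

(* Growing windows of Z, extended alternately to the right and to the left, so
   that the cylinders over them form a tree. *)
Fixpoint win n (x : conf) := if n is n'.+1 then ext (win n' x) (x (coord n'))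
  else [::].

Lemma size_win n x : size (win n x) = n.
Proof. by elim: n => //= n ih; rewrite size_ext ih. Qed.

Lemma win_block n x : win n x = block (- (n./2)%:Z) n x.
Proof.
elim: n => //= n ih; rewrite /ext size_win {}ih /coord.
rewrite uphalf_half; case: (boolP (odd n)) => od.
  rewrite block_cons NegzE add1n; congr (_ :: _).
  by rewrite -add1n PoszD opprD addrAC addNr add0r.
rewrite add0n block_rcons; congr (rcons _ (x _)).
rewrite -[X in _ = - _ + Posz X]odd_double_half (negbTE od) add0n -addnn PoszD.
by rewrite addrA addNr add0r.
Qed.

Lemma win_le m n x y : (m <= n)%N -> win n x = win n y -> win m x = win m y.
Proof.
elim: n => [|n ih]; first by rewrite leqn0 => /eqP ->.
rewrite leq_eqVlt => /predU1P[-> //|mn] /= e.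
by apply: ih => //; have [] := ext_inj _ e; rewrite ?size_win.
Qed.

Lemma measurable_block j n v :
  measurable ([set x | block j n x = v] : set Omega).
Proof.
elim: n j v => [|n ih] j [|a v] /=.
- by rewrite (_ : [set _ | _] = setT) //; apply/seteqP; split.
- by rewrite (_ : [set _ | _] = set0) //; apply/seteqP; split.
- by rewrite (_ : [set _ | _] = set0) //; apply/seteqP; split.
- rewrite (_ : [set _ | _] =
    ([set x | x j = a] `&` [set x | block (j + 1) n x = v] : set Omega)).
    by apply: measurableI; [exact: measurable_coord|exact: ih].
  apply/seteqP; split => x; rewrite /mkset block_cons; first by case.
  by move=> [/= -> ->].
Qed.

Lemma measurable_win n v : measurable ([set x | win n x = v] : set Omega).
Proof.
under eq_set do rewrite win_block.
exact: measurable_block.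
Qed.

Variable R : realType.

(** Two window cylinders are either nested or disjoint, so with the empty set they form a family
    closed under intersection that generates the sigma-algebra. *)
Lemma win_unique (m1 m2 : probability Omega R) :
  (forall v, m1 [set x | win (size v) x = v] = m2 [set x | win (size v) x = v]) ->
  forall A : set Omega, measurable A -> m1 A = m2 A.
Proof.
move=> m12.
pose G : set (set Omega) := [set set0] `|`
  [set A | exists v, A = [set x | win (size v) x = v]].
apply: (measure_unique G (fun=> setT)).
- apply/seteqP; split; last first.
    apply: smallest_sub; first exact: sigma_algebra_measurable.
    by move=> _ [->|[v ->]]; [exact: measurable0|exact: measurable_win].
  apply: smallest_sub; first exact: smallest_sigma_algebra.
  move=> _ [i [b ->]]; have [n <-] := coord_surj i.
  (* The condition at site [coord n] is a finite union of cylinders over the window of length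
     [n.+1], the first one containing that site. *)
  rewrite (_ : [set x | _] = \bigcup_(v in [set` words bool n])
     [set x | win n.+1 x = ext v b]).
    have := @fin_bigcup_measurable _ (g_sigma_algebraType G) _
      [set` words bool n] (fun v => [set x | win n.+1 x = ext v b]).
    apply => // v /=; rewrite mem_words => /eqP sv.
    by apply: sub_sigma_algebra; right; exists (ext v b); rewrite size_ext sv.
  apply/seteqP; split => [x /= <-|x [v /=]].
    by exists (win n x) => //=; rewrite mem_words size_win.
  rewrite mem_words => /eqP sv /= e.
  by have [] := ext_inj _ e; rewrite ?size_win.
- have key v w : (size v <= size w)%N ->
    G ([set x | win (size v) x = v] `&` [set x | win (size w) x = w]).
    move=> vw.
    have [[x [/= xv xw]]|n0] := pselect
      (exists x, ([set x | win (size v) x = v] `&` [set x | win (size w) x = w]) x).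
      right; exists w; apply/seteqP; split => y /= [//].
      move=> yw; split => //=; rewrite -[RHS]xv.
      by apply: win_le vw _; rewrite yw xw.
    left; apply/seteqP; split=> // y yy; apply: n0; by exists y.
  move=> _ _ [->|[v ->]] [->|[w ->]]; rewrite ?set0I ?setI0; try by left.
  have [vw|/ltnW wv] := leqP (size v) (size w); first exact: key.
  by rewrite setIC; exact: key.
- by move=> _; right; exists [::]; apply/seteqP; split.
- by rewrite bigcup_const//; exists 0%N.
- by move=> _ [->|[v ->]]; [rewrite !measure0|exact: m12].
- by move=> k; exact: (le_lt_trans (probability_le1 m1 measurableT) (ltry 1)).
Qed.

Definition omega_law (mu : probability Omega R) : seq bool -> R :=
  sys_law mu (shift : Omega -> Omega) (fun x : Omega => x 0).

Lemma omega_law_statlaw mu : shift_inv mu -> statlaw (omega_law mu).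
Proof.
move=> inv; apply: sys_law_statlaw => //; first exact: measurable_shift.
by move=> a; exact: measurable_coord.
Qed.

Lemma shift_inv_block (mu : probability Omega R) j n v : shift_inv mu ->
  mu ([set x | block j n x = v] : set Omega) =
  mu ([set x | block 0 n x = v] : set Omega).
Proof.
move=> inv.
have key k i : mu ([set x | block (i + k%:Z) n x = v] : set Omega) =
    mu ([set x | block i n x = v] : set Omega).
  have [_ <-] := shift_inv_iter k inv (measurable_block i n v).
  by congr (mu _); apply/seteqP; split => x /=; rewrite block_iter_shift.
(* [key] moves a block by nonnegative amounts only, so a negative start is moved up to 0. *)
case: j => k; first by rewrite -[Posz k]add0r key.
by rewrite -(key k.+1) NegzE addNr.
Qed.

Lemma omega_lawE mu v j : shift_inv mu ->
  omega_law mu v = fine (mu ([set x | block j (size v) x = v] : set Omega)).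
Proof.
move=> inv; rewrite /omega_law /sys_law shift_inv_block//.
by congr (fine (mu _)); apply/seteqP; split => x /=; rewrite itin_block.
Qed.

Lemma omega_law_unique (m1 m2 : probability Omega R) :
  shift_inv m1 -> shift_inv m2 -> omega_law m1 =1 omega_law m2 ->
  forall A : set Omega, measurable A -> m1 A = m2 A.
Proof.
move=> i1 i2 e; apply: win_unique => v.
have mv := measurable_win (size v) v.
rewrite -[LHS]fineK ?fin_num_measure// -[RHS]fineK ?fin_num_measure//.
congr _%:E; have := e v.
rewrite (omega_lawE _ (- (size v)./2%:Z) i1) (omega_lawE _ (- (size v)./2%:Z) i2).
by under eq_set do rewrite -win_block.
Qed.

End Windows.

(** * Construction of a stationary measure from its block law *)

Section QuantileMeasure.
Variables (R : realType).

Local Notation I01 := (`[0, 1[%classic : set R).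

Definition unit_interval_measure :=
  mrestr (@lebesgue_measure R) (measurable_itv `[(0 : R), 1[).

HB.instance Definition _ := Measure.on unit_interval_measure.

Lemma unit_interval_measure_setT : unit_interval_measure setT = 1%E.
Proof.
rewrite /unit_interval_measure /mrestr setTI lebesgue_measure_itv /= lte_fin.
by rewrite ltr01 oppr0 adde0.
Qed.

HB.instance Definition _ := Measure_isProbability.Build _ _ _
  unit_interval_measure unit_interval_measure_setT.

Variables (L : seq bool -> R) (HL : statlaw L).

Lemma law_ext v : L v = L (ext v false) + L (ext v true).
Proof.
rewrite /ext; case: ifP => _.
  by rewrite -(law_cons HL v) big_bool addrC.
by rewrite -(law_rcons HL v) big_bool addrC.
Qed.

(* Nested intervals: the points reaching [v] after [size v] steps form an
   interval of length [L v], and the first component is the position inside it. *)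
Fixpoint quantile_walk n (t : R) : R * seq bool :=
  if n is n'.+1 then
    let: (s, v) := quantile_walk n' t in
    if s < L (ext v false) then (s, ext v false)
    else (s - L (ext v false), ext v true)
  else (t, [::]).

Lemma size_quantile_walk n t : size (quantile_walk n t).2 = n.
Proof.
elim: n => //= n; case: (quantile_walk n t) => s v /= ih.
by case: ifP => _ /=; rewrite size_ext ih.
Qed.

Lemma quantile_walkS n t : exists b,
  (quantile_walk n.+1 t).2 = ext (quantile_walk n t).2 b.
Proof.
rewrite /=; case: (quantile_walk n t) => s v.
by case: ifP => _; [exists false|exists true].
Qed.

(** Site [k >= 0] is the right end of the window of length [2k + 1], and site [-(k + 1)] is the left
    end of the window of length [2k + 2]. *)
Definition quantile_conf (t : measurableTypeR R) : Omega := fun i =>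
  match i with
  | Posz k => last false (quantile_walk k.*2.+1 t).2
  | Negz k => head false (quantile_walk k.*2.+2 t).2
  end.

Lemma win_quantile_conf n t : win n (quantile_conf t) = (quantile_walk n t).2.
Proof.
elim: n => // n ih; rewrite [LHS]/= ih.
have [b e] := quantile_walkS n t; rewrite e; congr ext.
rewrite /coord; case: (boolP (odd n)) => od; rewrite /quantile_conf.
  rewrite (_ : n./2.*2.+2 = n.+1); last by rewrite -{2}(odd_double_half n) od.
  by rewrite e /ext size_quantile_walk od.
rewrite (_ : n./2.*2.+1 = n.+1); last first.
  by rewrite -{2}(odd_double_half n) (negbTE od).
by rewrite e /ext size_quantile_walk (negbTE od) last_rcons.
Qed.

(** Induction on the tree of windows, with [a] the left end of the interval of [v]. The recorded
    position [t - a] decides on which side of the next cut [t] falls. *)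
Lemma quantile_walk_fiber n v : size v = n -> exists a,
  [/\ forall t, (quantile_walk n t).2 = v -> (quantile_walk n t).1 = t - a,
      measurable [set t | (quantile_walk n t).2 = v] &
      I01 `&` [set t | (quantile_walk n t).2 = v] = `[a, a + L v[%classic].
Proof.
elim: n v => [|n ih] w sw.
  exists 0; case: w sw => //= _; split.
  - by move=> t _; rewrite subr0.
  - by rewrite (_ : [set _ | _] = setT) //; apply/seteqP; split.
  - by rewrite (law_nil HL) add0r setIidl.
have [v [b e]] := extP (w := w) ltac:(by rewrite sw).
have sv : size v = n by apply: succn_inj; rewrite -sw e size_ext.
have [a [a1 ma iv]] := ih v sv.
(* The cut point: the child [false] keeps the left piece of length [L (ext v false)], the child
   [true] the rest. *)
pose c := a + L (ext v false).
have L0 := law_ge0 HL (ext v false).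
have L1 := law_ge0 HL (ext v true).
have Lv := law_ext v.
have walk t : (quantile_walk n.+1 t).2 = w <->
    (quantile_walk n t).2 = v /\ (if b then c <= t else t < c).
  rewrite /=; have := a1 t; have := size_quantile_walk n t.
  case: (quantile_walk n t) => s u /= su su1.
  have -> : ((if s < L (ext u false) then (s, ext u false)
    else (s - L (ext u false), ext u true)).2 = w) <->
    (u = v /\ b = ~~ (s < L (ext u false))).
    rewrite e; case: ifP => _ /=; split; try by case=> -> ->.
    - by move=> /ext_inj[|-> <-//]; rewrite su sv.
    - by move=> /ext_inj[|-> <-//]; rewrite su sv.
  have cE : u = v -> (s < L (ext u false)) = (t < c).
    by move=> uv; rewrite uv (su1 uv) ltrBlDl.
  rewrite leNgt; split => -[uv]; rewrite cE//.
    by move=> ->; case: (t < c).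
  by case: (b); case: (t < c).
have walkE : [set t | (quantile_walk n.+1 t).2 = w] =
   [set t | (quantile_walk n t).2 = v] `&` (if b then `[c, +oo[ else `]-oo, c[)%classic.
  apply/seteqP; split => t /=.
    by move=> /walk[-> h]; split => //; case: (b) h; rewrite /= in_itv /= ?andbT.
  move=> [tv h]; apply/walk; split => //.
  by case: (b) h; rewrite /= in_itv /= ?andbT.
exists (if b then c else a); split.
- move=> t /walk[tv h]; rewrite /=; move: h tv (a1 t tv).
  case: (quantile_walk n t) => s u /= + -> ->.
  rewrite ltrBlDl -/c; case: (b) => h.
    by rewrite ltNge h /= /c opprD addrA.
  by rewrite h.
- by rewrite walkE; apply: measurableI => //; case: (b).
- rewrite walkE setIA iv e; apply/seteqP; split => t /=; rewrite !in_itv /=.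
    by case: (b); rewrite /= in_itv /= ?andbT /c; lra.
  by case: (b); rewrite /= in_itv /= ?andbT /c; lra.
Qed.

Lemma measurable_quantile_conf : measurable_fun setT quantile_conf.
Proof.
apply: measurable_to_Omega => i b; have [n <-] := coord_surj i.
rewrite (_ : [set t | _] = \bigcup_(v in [set` words bool n])
     [set t | (quantile_walk n.+1 t).2 = ext v b]).
  apply: fin_bigcup_measurable => // v /=; rewrite mem_words => /eqP sv.
  have [|a [_ + _]] := @quantile_walk_fiber n.+1 (ext v b); last exact.
  by rewrite size_ext sv.
apply/seteqP; split => [t <-|t [v +]].
  exists (quantile_walk n t).2; first by rewrite /= mem_words size_quantile_walk.
  by rewrite /mkset -!win_quantile_conf.
rewrite /mkset mem_words => /eqP sv; rewrite -win_quantile_conf => e.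
by have [] := ext_inj _ e; rewrite ?size_win.
Qed.

HB.instance Definition _ := isMeasurableFun.Build _ _ _ _ quantile_conf
  measurable_quantile_conf.

Definition quantile_measure : probability Omega R :=
  @distribution _ _ (measurableTypeR R) Omega R unit_interval_measure
    quantile_conf.

Lemma quantile_measure_win v :
  fine (quantile_measure ([set x | win (size v) x = v] : set Omega)) = L v.
Proof.
rewrite /quantile_measure /distribution /pushforward /=.
have [a [_ _ iv]] := quantile_walk_fiber (erefl (size v)).
rewrite /unit_interval_measure /mrestr.
rewrite (_ : _ `&` _ = `[a, a + L v[%classic).
  rewrite lebesgue_measure_itv /= lte_fin ltrDl.
  have := law_ge0 HL v; rewrite le_eqVlt => /predU1P[<-|->].
    by rewrite ltxx.
  by rewrite -EFinD /= addrAC subrr add0r.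
rewrite -iv setIC; congr (_ `&` _).
by apply/seteqP; split => t /=; rewrite win_quantile_conf.
Qed.

(** An arbitrary block sits inside a large centred window, where probabilities are known by
    construction; the other sites are summed out. *)
Lemma quantile_measure_block j v :
  fine (quantile_measure ([set x | block j (size v) x = v] : set Omega)) = L v.
Proof.
(* The window from [-K] to [K - 1] contains the block, which starts there at offset [l'] and leaves
   [r'] sites on its right. *)
pose n := size v; pose K := (`|j| + n)%N.
have [l' hl] : exists l' : nat, j = - K%:Z + l'%:Z.
  exists `|(j + K%:Z)%R|%N; rewrite gez0_abs; first by rewrite addrCA addNr addr0.
  by rewrite /K PoszD; lia.
have hK : (l' + n <= K.*2)%N by move: hl; rewrite /K -addnn !PoszD; lia.
have [r' hr] : exists r', K.*2 = (l' + (n + r'))%N.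
  by exists (K.*2 - (l' + n))%N; rewrite addnA subnKC.
rewrite (@fine_probability_partition _ _ _ quantile_measure _
  (words bool K.*2) (win K.*2)).
- transitivity (\sum_(w <- words bool K.*2)
     L w * (take n (drop l' w) == v)%:R).
    apply: eq_big_seq => w; rewrite mem_words => /eqP sw.
    have bw x : win K.*2 x = w -> block j n x = take n (drop l' w).
      rewrite win_block doubleK hr block_cat -hl => <-.
      rewrite drop_size_cat ?size_block// block_cat take_size_cat ?size_block//.
    case: eqP => tw.
      rewrite mulr1 -quantile_measure_win sw; congr (fine (quantile_measure _)).
      apply/seteqP; split => x /=; first by case.
      by move=> e; rewrite bw.
    rewrite mulr0 (_ : _ `&` _ = set0) ?measure0//.
    by apply/seteqP; split => x //= -[e1 /bw e2]; apply: tw; rewrite -e2.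
  (* Stationarity sums out the [l'] letters on the left, and then consistency the [r'] letters on
     the right. *)
  rewrite hr (sum_law_catr HL l' (n + r') (fun w => (take n w == v)%:R)).
  rewrite (sum_law_catl HL n r' (fun w => (w == v)%:R)).
  rewrite (bigD1_seq v) ?words_uniq ?mem_words//= eqxx mulr1 big1 ?addr0// => u.
  by move=> /negbTE ->; rewrite mulr0.
- exact: words_uniq.
- by move=> x _; rewrite mem_words size_win.
- exact: measurable_block.
- by move=> w; exact: measurable_win.
Qed.

(** Invariance need only be tested on window cylinders: the shift moves the window by one site, and
    block probabilities do not depend on the position. *)
Lemma measure_of_law : exists mu : probability Omega R,
  shift_inv mu /\ omega_law mu =1 L.
Proof.
have inv : shift_inv quantile_measure.
  move=> A mA.
  have ms : measurable_fun setT (shift : Omega -> Omega).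
    by move=> _ B mB; rewrite setTI; exact: measurable_shift.
  pose sh : {mfun Omega >-> Omega} := HB.pack (shift : Omega -> Omega)
    (isMeasurableFun.Build _ _ _ _ _ ms).
  apply: (win_unique (m1 := distribution quantile_measure sh)) => // v.
  rewrite -[LHS]fineK ?fin_num_measure//; last exact: measurable_win.
  rewrite -[RHS]fineK ?fin_num_measure//; last exact: measurable_win.
  congr _%:E; rewrite quantile_measure_win.
  rewrite -(quantile_measure_block (- (size v)./2%:Z + 1) v).
  rewrite /distribution /pushforward; congr (fine (quantile_measure _)).
  by apply/seteqP; split => x /=; rewrite win_block block_shift.
exists quantile_measure; split => // v.
by rewrite (omega_lawE _ 0 inv) quantile_measure_block.
Qed.

End QuantileMeasure.
(** * Free energies of factors of joinings *)

Section FreeEnergy.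
Variable R : realType.
Implicit Type mu : probability Omega R.

Lemma cyl_block n (w : {ffun 'I_n -> bool}) : cyl w = [set x | block 0 n x = codom w].
Proof.
have sc : size (codom w) = n by rewrite size_map size_enum_ord.
apply/seteqP; split => x /=.
  move=> xw; apply: (@eq_from_nth _ false); rewrite size_block ?sc// => i ni.
  rewrite (nth_map 0%N) ?size_iota// nth_iota// add0n add0r.
  rewrite (xw (Ordinal ni)) (nth_map (Ordinal ni)) ?size_enum_ord//.
  by congr (w _); apply: val_inj; rewrite /= nth_enum_ord.
move=> e [i ni]; have /(congr1 (fun s => nth false s i)) := e.
rewrite (nth_map 0%N) ?size_iota// nth_iota// add0n add0r => -> /=.
rewrite (nth_map (Ordinal ni)) ?size_enum_ord//; congr (w _); apply: val_inj.
by rewrite /= nth_enum_ord.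
Qed.

Lemma omega_law_cyl mu n (w : {ffun 'I_n -> bool}) :
  omega_law mu (codom w) = fine (mu (cyl w : set Omega)).
Proof.
rewrite /omega_law /sys_law size_map size_enum_ord cyl_block.
by congr (fine (mu _)); apply/seteqP; split => x /=; rewrite itin_block.
Qed.

Lemma omega_law1 mu a : omega_law mu [:: a] = sym_prob mu a.
Proof.
rewrite /omega_law /sys_law /sym_prob /=; congr (fine (mu _)).
by apply/seteqP; split => x /=; [case|move->].
Qed.

Lemma entropy_block mu : entropy mu =
  limn (fun n => n%:R^-1 * block_entropy (omega_law mu) n).
Proof.
rewrite /entropy; congr (limn _); apply/funext => n; congr (_ * - _).
rewrite -(sum_ffun_words n (fun v => omega_law mu v * log2 (omega_law mu v))).
by apply: eq_bigr => w _; rewrite omega_law_cyl.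
Qed.

(** For an invariant measure the [limn] in [entropy] is a true limit, and Fekete's lemma adds the
    bound at every finite length. *)
Lemma entropy_cvg mu : shift_inv mu ->
  (fun n => n%:R^-1 * block_entropy (omega_law mu) n) @ \oo --> entropy mu /\
  forall n, n%:R * entropy mu <= block_entropy (omega_law mu) n.
Proof.
move=> /omega_law_statlaw/block_entropy_cvg[h hc hl].
by rewrite entropy_block (cvg_lim _ hc).
Qed.

Definition mean_pot (phi : bool -> R) mu :=
  sym_prob mu false * phi false + sym_prob mu true * phi true.

Lemma Rintegral_pot (phi : bool -> R) mu :
  Rintegral mu setT (fun x : Omega => pot phi x) = mean_pot phi mu.
Proof.
pose A b : set Omega := [set x | x 0 = b].
have mA b : measurable (A b) by exact: measurable_coord.
have TA : setT = A false `|` A true.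
  by apply/seteqP; split => // x _; rewrite /A /=; case: (x 0); [right|left].
have mpot : measurable_fun setT (fun x : Omega => pot phi x).
  move=> _ B mB; rewrite setTI.
  rewrite (_ : _ @^-1` _ = \bigcup_(b in [set b | B (phi b)]) A b).
    by apply: fin_bigcup_measurable.
  apply/seteqP; split => [x Bx|x [b Bb xb]]; first by exists (x 0).
  by rewrite /preimage /pot /= xb.
have ipot : mu.-integrable setT (EFin \o (fun x : Omega => pot phi x)).
  apply: measurable_bounded_integrable => //.
    by rewrite (le_lt_trans (probability_le1 mu measurableT)) ?ltry.
  exists (`|phi false| + `|phi true|); split; first exact: num_real.
  move=> M hM x _; rewrite /pot; apply: ltW; apply: le_lt_trans hM.
  by case: (x 0); rewrite ?lerDl ?lerDr.
rewrite TA Rintegral_setU//; last first.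
- by apply/disj_setPS => x []; rewrite /A /= => ->.
- by rewrite -TA.
have e b : \int[mu]_(x in A b) pot phi x = sym_prob mu b * phi b.
  rewrite (@eq_Rintegral _ _ _ _ _ (fun=> phi b)).
    by rewrite Rintegral_cst// mulrC.
  by move=> x; rewrite inE /A /pot /= => ->.
by rewrite !e.
Qed.

Lemma free_energyE (phi : bool -> R) mu :
  free_energy phi mu = entropy mu + mean_pot phi mu.
Proof. by rewrite /free_energy Rintegral_pot. Qed.

End FreeEnergy.

(** * Existence of the Bernoulli measure *)

Section BernoulliMeasure.
Variables (R : realType) (p : R).
Hypotheses (p0 : 0 <= p) (p1 : p <= 1).

Let q (b : bool) : R := if b then 1 - p else p.

Lemma bernoulli_statlaw : statlaw (fun v : seq bool => \prod_(b <- v) q b).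
Proof.
split.
- move=> v; apply: prodr_ge0 => -[] _; rewrite /q ?subr_ge0//.
- by rewrite big_nil.
- move=> v; rewrite big_bool /= !big_cons -mulrDl.
  by rewrite [X in X * _](_ : _ = 1) ?mul1r// /q; lra.
- move=> v; rewrite big_bool /= -!cats1 !big_cat !big_seq1 /= -mulrDr.
  by rewrite [X in _ * X](_ : _ = 1) ?mulr1// /q; lra.
Qed.

(** The block law gives the formula for intervals of sites only; an arbitrary finite set of sites is
    reached by forgetting coordinates of an interval around it. *)
Lemma bernoulli_measure_exists : exists beta : probability Omega R,
  shift_inv beta /\ bernoulli_seq p beta.
Proof.
have [beta [inv law]] := measure_of_law bernoulli_statlaw.
exists beta; split => //.
pose E (s : seq int) (w : int -> bool) : set Omega := [set x | forall i, i \in s -> x i = w i].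
pose G s := forall w, measurable (E s w) /\ fine (beta (E s w)) = \prod_(i <- s) q (w i).
have Gperm s t : perm_eq s t -> G s -> G t.
  move=> st Gs w; have -> : E t w = E s w.
    by apply/seteqP; split => x h i si; apply: h; rewrite ?(perm_mem st)//
      -(perm_mem st).
  by rewrite -(perm_big _ st); exact: Gs.
have Gcons c s : c \notin s -> G (c :: s) -> G s.
  move=> cs Gcs w.
  (* [u b] prescribes [b] at the forgotten site [c]; the weights of the two choices add up to 1. *)
  pose u b : int -> bool := fun i => if i == c then b else w i.
  have EU : E s w = E (c :: s) (u false) `|` E (c :: s) (u true).
    apply/seteqP; split => x.
      move=> h; case xc : (x c); [right|left]; move=> i; rewrite inE /u.
        by case: eqP => [->//|_ /= /h].
      by case: eqP => [->//|_ /= /h].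
    move=> [] h i si; have := h i; rewrite inE si orbT /u => ->//;
      by case: eqP => // ic; move: cs; rewrite -ic si.
  have [m0 e0] := Gcs (u false); have [m1 e1] := Gcs (u true).
  rewrite EU; split; first exact: measurableU.
  rewrite fine_probabilityU// ?e0 ?e1; last first.
    rewrite -subset0 => x [/(_ c) h0 /(_ c) h1].
    by move: h0 h1; rewrite inE eqxx /u eqxx => ->// /(_ isT).
  rewrite !big_cons {1 3}/u eqxx.
  have es b : \prod_(i <- s) q (u b i) = \prod_(i <- s) q (w i).
    apply: eq_big_seq => i si; rewrite /u; case: eqP => // ic.
    by move: cs; rewrite -ic si.
  by rewrite !es -mulrDl [X in X * _](_ : _ = 1) ?mul1r// /q; lra.
pose t K : seq int := [seq - K%:Z + i%:Z | i <- iota 0 K.*2].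
have Gt K : G (t K).
  move=> w; pose v := [seq w i | i <- t K].
  have -> : E (t K) w = [set x | block (- K%:Z) (size v) x = v].
    rewrite /v !size_map size_iota; apply/seteqP; split => x.
      by move=> h; rewrite /mkset /block -map_comp; apply/eq_in_map => i iK /=; apply: h; apply: map_f.
    by rewrite /mkset /block -map_comp => /eq_in_map h i /mapP[j jK ->]; exact: h.
  split; first exact: measurable_block.
  by rewrite -(omega_lawE _ _ inv) law big_map.
have Gsub r s : uniq (r ++ s) -> G (r ++ s) -> G s.
  elim: r => //= c r ih /andP[crs urs] /(Gcons _ _ crs); exact: ih.
move=> s w us.
(* [K] exceeds every [|i|] with [i] in [s], so the interval [t K] contains [s]. *)
pose K := (\sum_(i <- s) `|i|%N).+1.
have sK : {subset s <= t K}.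
  move=> i si; have : (`|i| < K)%N.
    by rewrite ltnS (big_rem i)//= leq_addr.
  move=> iK; apply/mapP; exists (`|(i + K%:Z)%R|%N).
    by rewrite mem_iota; lia.
  by lia.
have ut : uniq (t K).
  by rewrite map_inj_uniq ?iota_uniq// => i j; lia.
pose r := [seq i <- t K | i \notin s].
have pr : perm_eq (t K) (r ++ s).
  apply: uniq_perm => //.
    rewrite cat_uniq filter_uniq// us andbT; apply/hasPn => i si.
    by rewrite mem_filter si.
  move=> i; rewrite mem_cat mem_filter; case: (boolP (i \in s)) => //= si.
    by rewrite sK.
  by rewrite orbF.
have urs : uniq (r ++ s) by rewrite -(perm_uniq pr).
have [mE e] := Gsub _ _ urs (Gperm _ _ pr (Gt K)) w.
by rewrite -[LHS]fineK ?fin_num_measure// -e.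
Qed.

End BernoulliMeasure.

(** * The joint process of the base and the product *)

Section JointLaw.
Variable R : realType.
Implicit Types (mu nu beta : probability Omega R)
  (lam : probability (Omega * Omega)%type R).

Definition shift2 (z : Omega * Omega) : Omega * Omega := (shift z.1, shift z.2).

(** The second track records the product, not the second coordinate, so its law is that of the image
    under [Mmul]. *)
Definition masked_symbol (z : Omega * Omega) : bool * bool :=
  (z.1 0, z.1 0 && z.2 0).

Definition joint_law lam := sys_law lam shift2 masked_symbol.

Lemma measurable_coord1 i b : measurable ([set z | z.1 i = b] : set (Omega * Omega)).
Proof.
rewrite (_ : [set _ | _] = fst @^-1` ([set x | x i = b] : set Omega)) //.
rewrite -[X in measurable X]setTI; apply: measurable_fst => //.
exact: measurable_coord.
Qed.

Lemma measurable_coord2 i b : measurable ([set z | z.2 i = b] : set (Omega * Omega)).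
Proof.
rewrite (_ : [set _ | _] = snd @^-1` ([set x | x i = b] : set Omega)) //.
rewrite -[X in measurable X]setTI; apply: measurable_snd => //.
exact: measurable_coord.
Qed.

Lemma measurable_Mmul : measurable_fun setT Mmul.
Proof.
apply: measurable_to_Omega => i [].
  rewrite (_ : [set _ | _] = [set z : Omega * Omega | z.1 i = true] `&`
    [set z | z.2 i = true]).
    by apply: measurableI; [exact: measurable_coord1|exact: measurable_coord2].
  apply/seteqP; split => z /=; rewrite /Mmul; first by move=> /andP[].
  by move=> [-> ->].
rewrite (_ : [set _ | _] = [set z : Omega * Omega | z.1 i = false] `|`
    [set z | z.2 i = false]).
  by apply: measurableU; [exact: measurable_coord1|exact: measurable_coord2].
apply/seteqP; split => z /=; rewrite /Mmul.
  by case: (z.1 i) => /=; [right|left].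
by move=> [] ->; rewrite ?andbF.
Qed.

Lemma measurable_masked_symbol s : measurable [set z | masked_symbol z = s].
Proof.
case: s => a b.
rewrite (_ : [set _ | _] = [set z : Omega * Omega | z.1 0 = a] `&`
    Mmul @^-1` ([set x | x 0 = b] : set Omega)).
  apply: measurableI; first exact: measurable_coord1.
  by rewrite -[X in measurable X]setTI; apply: measurable_Mmul => //; exact: measurable_coord.
by apply/seteqP; split => z /=; [case|move=> [<- <-]].
Qed.

Lemma measurable_shift2_fun : measurable_fun setT shift2.
Proof.
apply: measurable_fun_pair; apply: measurable_to_Omega => i b.
  exact: measurable_coord1.
exact: measurable_coord2.
Qed.

Lemma measurable_shift2 (A : set (Omega * Omega)) : measurable A ->
  measurable (shift2 @^-1` A).
Proof.
by move=> mA; rewrite -[X in measurable X]setTI; exact: measurable_shift2_fun.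
Qed.

Lemma joint_law_statlaw lam : shift_inv2 lam -> statlaw (joint_law lam).
Proof.
move=> inv; apply: sys_law_statlaw => //.
  exact: measurable_shift2.
exact: measurable_masked_symbol.
Qed.

Lemma itin_fst n z :
  itin shift2 (fst \o masked_symbol) n z = itin shift (fun x : conf => x 0) n z.1.
Proof. by elim: n z => //= n ih z; rewrite ih. Qed.

Lemma itin_snd n z :
  itin shift2 (snd \o masked_symbol) n z =
  itin shift (fun x : conf => x 0) n (Mmul z).
Proof. by elim: n z => //= n ih z; rewrite ih. Qed.

Lemma joint_law_fst lam nu u :
  (forall A : set Omega, measurable A -> lam (fst @^-1` A) = nu A) ->
  \sum_(w <- words (bool * bool)%type (size u) | map fst w == u) joint_law lam w
  = omega_law nu u.
Proof.
move=> lnu; rewrite sys_law_map; last exact: measurable_masked_symbol.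
  rewrite /omega_law /sys_law -lnu.
    by congr (fine (lam _)); apply/seteqP; split => z /=; rewrite itin_fst.
  under eq_set do rewrite itin_block; exact: measurable_block.
exact: measurable_shift2.
Qed.

Lemma joint_law_snd lam mu z : is_push_M mu lam ->
  \sum_(w <- words (bool * bool)%type (size z) | map snd w == z) joint_law lam w
  = omega_law mu z.
Proof.
move=> lmu; rewrite sys_law_map; last exact: measurable_masked_symbol.
  rewrite /omega_law /sys_law lmu.
    by congr (fine (lam _)); apply/seteqP; split => y /=; rewrite itin_snd.
  under eq_set do rewrite itin_block; exact: measurable_block.
exact: measurable_shift2.
Qed.

Lemma all_itin_masked n z :
  all (fun s : bool * bool => s.2 ==> s.1) (itin shift2 masked_symbol n z).
Proof.
elim: n z => //= n ih z; rewrite ih andbT.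
by apply/implyP => /andP[].
Qed.

Lemma joint_law_supp lam w :
  ~~ all (fun s : bool * bool => s.2 ==> s.1) w -> joint_law lam w = 0.
Proof.
move=> bad; rewrite /joint_law /sys_law (_ : [set _ | _] = set0) ?measure0//.
apply/seteqP; split => z //= e.
by move: bad; rewrite -e all_itin_masked.
Qed.

Definition bernoulli_weight (phi : bool -> R) :=
  (2 : R) `^ phi false / ((2 : R) `^ phi false + (2 : R) `^ phi true).

Definition target_pressure (phi : bool -> R) nu :=
  sym_prob nu false * phi false
  + sym_prob nu true * log2 ((2 : R) `^ phi false + (2 : R) `^ phi true).

Lemma bernoulli_weight_gt0 phi : 0 < bernoulli_weight phi.
Proof. by rewrite divr_gt0 ?addr_gt0 ?powR_gt0. Qed.

Lemma bernoulli_weight1 phi : 1 - bernoulli_weight phi =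
  (2 : R) `^ phi true / ((2 : R) `^ phi false + (2 : R) `^ phi true).
Proof.
have S0 : 0 < (2 : R) `^ phi false + (2 : R) `^ phi true.
  by rewrite addr_gt0 ?powR_gt0.
by rewrite /bernoulli_weight; field; rewrite gt_eqF.
Qed.

Lemma bernoulli_weight_lt1 phi : bernoulli_weight phi < 1.
Proof. by rewrite -subr_gt0 bernoulli_weight1 divr_gt0 ?addr_gt0 ?powR_gt0. Qed.

(** For this [p] the kernel at [(true, b)] has logarithm [phi b] minus the logarithm of the
    normalising sum, at [(false, false)] it has logarithm 0, and [(false, true)] has probability
    0. *)
Lemma joint_energy phi lam mu nu :
  (forall A : set Omega, measurable A -> lam (fst @^-1` A) = nu A) ->
  is_push_M mu lam ->
  - mask_energy (bernoulli_weight phi) (joint_law lam) =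
  target_pressure phi nu - mean_pot phi mu.
Proof.
move=> lnu lmu; pose L := joint_law lam.
have S0 : 0 < (2 : R) `^ phi false + (2 : R) `^ phi true.
  by rewrite addr_gt0 ?powR_gt0.
have sumW (P : pred (seq (bool * bool))) (F : seq (bool * bool) -> R) :
    \sum_(w <- words (bool * bool)%type 1 | P w) F w = \sum_(s | P [:: s]) F [:: s].
  rewrite big_mkcond sum_wordsS [RHS]big_mkcond.
  by apply: eq_bigr => s _; rewrite sum_words0.
have sumB (F : bool * bool -> R) :
    \sum_s F s = F (true, true) + F (true, false) + (F (false, true) + F (false, false)).
  rewrite (eq_bigr (fun s => F (s.1, s.2))); last by case.
  by rewrite -(pair_bigA _ (fun a b => F (a, b))) /= !big_bool.
have L01 : L [:: (false, true)] = 0 by exact: joint_law_supp.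
have N b : sym_prob nu b = L [:: (b, true)] + L [:: (b, false)].
  rewrite -omega_law1 -(joint_law_fst [:: b] lnu) /= sumW big_mkcond sumB.
  by case: b => /=; rewrite ?addr0 ?add0r.
have M b : sym_prob mu b = L [:: (true, b)] + L [:: (false, b)].
  rewrite -omega_law1 -(joint_law_snd [:: b] lmu) /= sumW big_mkcond sumB.
  by case: b => /=; rewrite ?addr0 ?add0r.
rewrite /mask_energy sumB /mask_kernel /= -/L /target_pressure /mean_pot !N !M.
rewrite log2_1 L01 bernoulli_weight1 /bernoulli_weight.
rewrite !log2M ?invr_gt0 ?powR_gt0// log2V// !log2_powR.
ring.
Qed.

End JointLaw.

(** * The product of the base measure and a Bernoulli measure *)

Section ProductLaw.
Variables (R : realType) (nu beta : probability Omega R).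
Hypotheses (inu : shift_inv nu) (ibeta : shift_inv beta).

Definition product_prob : probability (Omega * Omega)%type R := (nu \x beta)%E.
Local Notation lam := product_prob.

Lemma product_probX (A B : set Omega) : measurable A -> measurable B ->
  lam (A `*` B) = (nu A * beta B)%E.
Proof. exact: product_measure1E. Qed.

(** The image of the product under the shift agrees with it on rectangles, which determine a product
    measure. *)
Lemma product_shift_inv2 : shift_inv2 lam.
Proof.
move=> A mA.
pose sh : {mfun (Omega * Omega)%type >-> (Omega * Omega)%type} := HB.pack shift2
    (isMeasurableFun.Build _ _ _ _ shift2 measurable_shift2_fun).
rewrite [RHS](@product_measure_unique _ _ _ _ R nu beta (distribution lam sh))//.
move=> B C mB mC; rewrite /distribution /pushforward.
transitivity (lam ((shift @^-1` B : set Omega) `*` (shift @^-1` C : set Omega))).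
  by congr (lam _); apply/seteqP; split.
rewrite product_probX ?inu ?ibeta//; exact: measurable_shift.
Qed.

Lemma product_fst (A : set Omega) : measurable A -> lam (fst @^-1` A) = nu A.
Proof.
move=> mA; rewrite (_ : fst @^-1` A = A `*` setT).
  by rewrite product_probX// probability_setT mule1.
by apply/seteqP; split => z //= [].
Qed.

Lemma itin_nthP (T S : Type) (tau : T -> T) (f : T -> S) (s0 : S) w t :
  itin tau f (size w) t = w <->
  forall i, (i < size w)%N -> f (iter i tau t) = nth s0 w i.
Proof.
split=> [e i iw|h]; first by rewrite -e nth_itin// -(size_itin tau f (size w) t) e.
by apply: (@eq_from_nth _ s0); rewrite size_itin// => i iw; rewrite nth_itin// h.
Qed.

Lemma iter_shift2 k z : iter k shift2 z = (iter k shift z.1, iter k shift z.2).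
Proof. by elim: k => [|k ih] /=; [case: z|rewrite ih]. Qed.

(** Once the base block is fixed, the event constrains [y] only at the sites where the base is 1, so
    it is a rectangle. If some site has base 0 and product 1, both sides vanish. *)
Lemma joint_law_product p w : bernoulli_seq p beta ->
  joint_law lam w = omega_law nu (map fst w) * mask_prod p w.
Proof.
move=> bs; have [below|bad] := boolP (all (fun s : bool * bool => s.2 ==> s.1) w);
  last first.
  rewrite joint_law_supp//; have /allPn[[a b] abw ab] := bad.
  rewrite /mask_prod (big_rem _ abw) /=.
  by case: a b ab {abw} => [] [] //= _; rewrite /mask_kernel /= mul0r mulr0.
pose d := (false, false); pose n := size w.
(* The sites where the base is 1; there the product equals [y], and [g] gives the required value. *)
pose s : seq int := [seq Posz i | i <- iota 0 n & (nth d w i).1].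
pose g (j : int) := (nth d w `|j|%N).2.
have us : uniq s.
  by rewrite map_inj_uniq ?filter_uniq ?iota_uniq// => i j [].
have mN : measurable ([set x | itin shift (fun x : conf => x 0) n x = map fst w] : set Omega).
  by under eq_set do rewrite itin_block; exact: measurable_block.
have -> : mask_prod p w = fine (beta [set y | forall i, i \in s -> y i = g i]).
  rewrite bs// /= big_map big_filter /mask_prod (big_nth d) /index_iota subn0.
  rewrite [RHS]big_mkcond big_seq [RHS]big_seq; apply: eq_bigr => i.
  rewrite mem_iota /= => iw; have := all_nthP d below i iw.
  by rewrite /g /mask_kernel absz_nat; case: (nth d w i) => [[] []].
have mB : measurable ([set y | forall i, i \in s -> y i = g i] : set Omega).
  rewrite (_ : [set _ | _] = \bigcap_(i in [set` s]) [set y : Omega | y i = g i]).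
    by apply: fin_bigcap_measurable => // i _; exact: measurable_coord.
  by apply/seteqP; split => y h i; exact: h.
rewrite /omega_law /joint_law /sys_law size_map -fineM ?fin_num_measure//.
rewrite -product_probX//; congr (fine (lam _)).
apply/seteqP; split => z /=.
  move/(itin_nthP _ _ d) => h; split.
    apply/esym; apply: (@eq_from_nth _ false); rewrite size_map ?size_itin// => i iw.
    by rewrite (nth_map d)// nth_itin// -h// iter_shift2.
  move=> i /mapP[k + ->]; rewrite mem_filter mem_iota /= => /andP[k1 kw].
  rewrite /g absz_nat; have := h k kw; rewrite iter_shift2 /masked_symbol /=.
  rewrite !iter_shiftE !add0r => e; move: k1; rewrite -e /= => ->.
  by [].
move=> [h1 h2]; apply/(itin_nthP _ _ d) => k kw.
have := congr1 (fun s => nth false s k) h1.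
rewrite nth_itin// (nth_map d)// => e1.
rewrite iter_shift2 /masked_symbol /= e1.
have := all_nthP d below k kw; have := h2 k.
rewrite iter_shiftE add0r /g absz_nat.
case ek : (nth d w k) => [[] b] /=; last by case: b {ek}.
move=> -> //; apply: map_f; by rewrite mem_filter ek mem_iota.
Qed.

End ProductLaw.

(** * Free energies of invariant measures and the equality case *)

Section EquilibriumStates.
Variables (R : realType) (X : set conf) (nu : probability Omega R).
Variable phi : bool -> R.
Hypotheses (inu : shift_inv nu) (hX : mt_subordinate X nu).
Hypothesis entropy0 : entropy nu = 0.

Let p := bernoulli_weight phi.
Let F := target_pressure phi nu.

Lemma block_entropy_base_cvg :
  (fun n => n%:R^-1 * block_entropy (omega_law nu) n) @ \oo --> (0 : R).
Proof. by have [h _] := entropy_cvg inu; rewrite entropy0 in h. Qed.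

Lemma block_entropy_inv_le mu n : inv_on X mu ->
  block_entropy (omega_law mu) n + n%:R * mean_pot phi mu
  <= block_entropy (omega_law nu) n + n%:R * F.
Proof.
move=> imu; have [lam [ilam [lnu lmu]]] := (hX.2 mu).1 imu.
have := @block_entropy_mask_le _ p (bernoulli_weight_gt0 phi)
  (bernoulli_weight_lt1 phi) (omega_law nu) (omega_law mu) (joint_law lam)
  (omega_law_statlaw inu) (joint_law_statlaw ilam) _ _ _ n.
move=> /(_ (fun u => joint_law_fst u lnu) (fun z => joint_law_snd z lmu)).
move=> /(_ (@joint_law_supp _ lam)).
rewrite -mulrN (joint_energy phi lnu lmu) mulrBr; rewrite -/F; lra.
Qed.

(** The block inequality divided by [n]; the base contributes [H_n(nu) / n], which tends to 0. *)
Lemma free_energy_le mu : inv_on X mu -> free_energy phi mu <= F.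
Proof.
move=> imu; rewrite free_energyE -lerBrDr.
have [hmu _] := entropy_cvg imu.1.
have hn : (fun n => n%:R^-1 * block_entropy (omega_law nu) n
     + (F - mean_pot phi mu)) @ \oo --> 0 + (F - mean_pot phi mu).
  by apply: cvgD; [exact: block_entropy_base_cvg|exact: cvg_cst].
rewrite add0r in hn; apply: ler_cvg_to hmu hn _.
exists 1%N => // n /= n1; have nR : 0 < n%:R :> R by rewrite ltr0n.
rewrite ler_pdivrMl// mulrDr mulVKf ?gt_eqF//.
have := block_entropy_inv_le n imu; rewrite mulrBr; lra.
Qed.

Lemma masked_bernoulli_exists : exists (mu beta : probability Omega R)
    (lam : probability (Omega * Omega)%type R),
  [/\ inv_on X mu, bernoulli_seq p beta, is_product nu beta lam
    & is_push_M mu lam] /\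
  [/\ shift_inv2 lam,
      (forall A : set Omega, measurable A -> lam (fst @^-1` A) = nu A)
    & forall w, joint_law lam w = omega_law nu (map fst w) * mask_prod p w].
Proof.
have [beta [ibeta bs]] := bernoulli_measure_exists
  (ltW (bernoulli_weight_gt0 phi)) (ltW (bernoulli_weight_lt1 phi)).
pose lam := product_prob nu beta.
pose M : {mfun (Omega * Omega)%type >-> Omega} := HB.pack Mmul
    (isMeasurableFun.Build _ _ _ _ Mmul measurable_Mmul).
exists (distribution lam M), beta, lam; split; split => //.
- apply/(hX.2 _).2; exists lam; split; first exact: product_shift_inv2.
  by split => // A mA; exact: product_fst.
- exact: product_probX.
- exact: product_shift_inv2.
- by move=> A mA; exact: product_fst.
- by move=> w; exact: joint_law_product.
Qed.

(** The bound is kept at every [n], not only in the limit, because it also bounds the partition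
    function from below. *)
Lemma free_energy_masked (mu : probability Omega R)
    (lam : probability (Omega * Omega)%type R) :
  inv_on X mu -> shift_inv2 lam ->
  (forall A : set Omega, measurable A -> lam (fst @^-1` A) = nu A) ->
  is_push_M mu lam ->
  (forall w, joint_law lam w = omega_law nu (map fst w) * mask_prod p w) ->
  (forall n, n%:R * (F - mean_pot phi mu) <= block_entropy (omega_law mu) n) /\
  free_energy phi mu = F.
Proof.
move=> imu ilam lnu lmu lw.
have low n : n%:R * (F - mean_pot phi mu) <= block_entropy (omega_law mu) n.
  have := @block_entropy_mask_ge _ p (bernoulli_weight_gt0 phi)
    (bernoulli_weight_lt1 phi) (omega_law nu) (omega_law mu) (joint_law lam)
    (omega_law_statlaw inu) (omega_law_statlaw imu.1) (joint_law_statlaw ilam).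
  move=> /(_ (fun u => joint_law_fst u lnu) (fun z => joint_law_snd z lmu)).
  move=> /(_ (@joint_law_supp _ lam) n lw).
  by rewrite -mulrN (joint_energy phi lnu lmu).
split => //; apply/eqP; rewrite eq_le free_energy_le//= free_energyE -lerBlDr.
have [hmu _] := entropy_cvg imu.1.
apply: ler_cvg_to (cvg_cst _) hmu _.
exists 1%N => // n /= n1; have nR : 0 < n%:R :> R by rewrite ltr0n.
by rewrite -ler_pdivrMl ?invr_gt0// invrK.
Qed.

(** Maximality and Fekete's bound give [n * (F - E phi) <= n * h(mu) <= H_n(mu)], the lower bound
    needed for uniqueness of the masked law. *)
Lemma equilibrium_joint_law (mu : probability Omega R)
    (lam : probability (Omega * Omega)%type R) :
  inv_on X mu -> F <= free_energy phi mu -> shift_inv2 lam ->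
  (forall A : set Omega, measurable A -> lam (fst @^-1` A) = nu A) ->
  is_push_M mu lam ->
  forall w, joint_law lam w = omega_law nu (map fst w) * mask_prod p w.
Proof.
move=> imu hF ilam lnu lmu.
apply: (@masked_law_unique _ p (bernoulli_weight_gt0 phi)
    (bernoulli_weight_lt1 phi) (omega_law nu) (omega_law mu) (joint_law lam)
    (omega_law_statlaw inu) (joint_law_statlaw ilam)
    (fun u => joint_law_fst u lnu) (fun z => joint_law_snd z lmu)
    (@joint_law_supp _ lam) block_entropy_base_cvg).
move=> n; rewrite -mulrN (joint_energy phi lnu lmu).
have [_ /(_ n)] := entropy_cvg imu.1; apply: le_trans.
by rewrite ler_wpM2l// lerBlDr -free_energyE.
Qed.

End EquilibriumStates.

(** * Pressure *)

Section UltraLimits.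
Variables (R : realType) (U : set_system nat).
Hypothesis UU : UltraFilter U.

Lemma fmap_ultra (T : Type) (a : nat -> T) : UltraFilter (a @ U).
Proof.
split; first exact: fmap_proper_filter.
move=> G PG sub; apply/seteqP; split => // A GA.
have [//|UnA] := in_ultra_setVsetC (a @^-1` A) UU.
have GnA : G (~` A) by exact: sub.
by have := @filter_not_empty _ G PG; rewrite -(setICr A) => /(_ (filterI GA GnA)).
Qed.

(** Compactness of the unit interval. A fixed ultrafilter makes all block frequencies converge at
    once, so no diagonal subsequence has to be extracted. *)
Lemma ultra_bounded_cvg (a : nat -> R) : (forall n, 0 <= a n <= 1) ->
  exists l : R, a @ U --> l.
Proof.
move=> a01; have := @segment_compact R 0 1; rewrite compact_ultra.
move=> /(_ (a @ U) (fmap_ultra a))[|l [_ al]]; last by exists l.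
suff : U (a @^-1` `[0, 1]%classic) by [].
by apply: filterE => n /=; rewrite in_itv /=; exact: a01.
Qed.

End UltraLimits.

Lemma ptws_cvg_eventually_eq (I T : Type) (V : topologicalType) (F : set_system T)
    (z : T -> I -> V) (x : I -> V) : Filter F ->
  (forall i, \forall n \near F, z n i = x i) ->
  (z : T -> {ptws I -> V}) @ F --> (x : {ptws I -> V}).
Proof.
move=> FF h; apply/cvg_sup => i A.
rewrite nbhsE => -[B [[C oC <-] Cx] BA].
have := h i; apply: filterS => n zx.
by apply: BA; rewrite /preimage /= in Cx *; rewrite zx.
Qed.

(** * The language of a subshift and measures supported on it *)

Section Language.
Variables (R : realType) (X : set conf).
Hypothesis subX : subshift X.

Definition in_lang (v : seq bool) := exists2 x, X x & block 0 (size v) x = v.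

Lemma subshift_iter k x : X x -> X (iter k shift x).
Proof.
elim: k => // k ih Xx; rewrite iterS -subX.2; exists (iter k shift x) => //.
exact: ih.
Qed.

Lemma subshift_iter_surj k x : X x -> exists2 y, X y & iter k shift y = x.
Proof.
elim: k x => [|k ih] x Xx; first by exists x.
move: Xx; rewrite -{1}subX.2 => -[y Xy yx].
by have [z Xz zy] := ih y Xy; exists z => //=; rewrite zy.
Qed.

Lemma in_lang_block j n x : X x -> in_lang (block j n x).
Proof.
move=> Xx; rewrite /in_lang size_block; case: j => k.
  exists (iter k shift x); first exact: subshift_iter.
  by rewrite block_iter_shift add0r.
(* A negative start uses that the shift maps [X] onto itself: the block is read at 0 in a preimage
   of [x]. *)
have [y Xy <-] := subshift_iter_surj k.+1 Xx.
by exists y => //; rewrite block_iter_shift NegzE addNr.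
Qed.

(** Such an [x] is a pointwise limit of points of [X] that agree with it on growing centred windows,
    and [X] is closed. *)
Lemma subshift_of_blocks x :
  (forall N : nat, in_lang (block (- N%:Z) N.*2 x)) -> X x.
Proof.
move=> h.
have {}h N : exists z, X z /\ block (- N%:Z) N.*2 z = block (- N%:Z) N.*2 x.
  have [y Xy] := h N; rewrite size_block => e.
  exists (iter N shift y); split; first exact: subshift_iter.
  by rewrite block_iter_shift addNr.
have [z hz] := choice h.
apply: (@closed_cvg nat {ptws int -> bool} \oo _ z X subX.1).
  by apply: nearW => N; exact: (hz N).1.
apply: ptws_cvg_eventually_eq => i.
exists (`|i|%N.+1) => // N /= iN.
have := congr1 (fun s => nth false s `|(i + N%:Z)%R|%N) (hz N).2.
have iN2 : (`|(i + N%:Z)%R| < N.*2)%N by lia.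
rewrite !(nth_map 0%N) ?size_iota// nth_iota// add0n.
by have -> : - N%:Z + `|(i + N%:Z)%R|%N%:Z = i by lia.
Qed.

Lemma measurable_in_lang_block j n :
  measurable ([set x | in_lang (block j n x)] : set Omega).
Proof.
rewrite (_ : [set _ | _] = \bigcup_(v in [set v | v \in words bool n /\ in_lang v])
   ([set x | block j n x = v] : set Omega)).
  apply: fin_bigcup_measurable => [|v _]; last exact: measurable_block.
  by apply: (@sub_finite_set _ _ [set` words bool n]) => // v [].
apply/seteqP; split => x /=.
  by move=> lx; exists (block j n x) => //=; rewrite mem_words size_block.
by move=> [v [_ lv] /= ->].
Qed.

Lemma subshiftE : X = \bigcap_N [set x | in_lang (block (- N%:Z) N.*2 x)].
Proof.
apply/seteqP; split => x.
  by move=> Xx N _; exact: in_lang_block.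
by move=> h; apply: subshift_of_blocks => N; exact: h.
Qed.

Lemma measurable_subshift : measurable (X : set Omega).
Proof.
rewrite subshiftE; apply: bigcapT_measurable => N.
exact: measurable_in_lang_block.
Qed.

Lemma inv_on_lang (mu : probability Omega R) v : inv_on X mu ->
  0 < omega_law mu v -> in_lang v.
Proof.
move=> [inv muX]; apply: contraPP => nv; apply/negP; rewrite -leNgt.
rewrite (omega_lawE _ 0 inv).
have mX := measurable_subshift.
have : mu (~` (X : set Omega)) = 0%E by rewrite probability_setC// muX subee.
move=> X0; rewrite (_ : mu _ = 0%E)//; apply/eqP; rewrite eq_le measure_ge0 andbT.
rewrite -X0; apply: le_measure; rewrite ?inE.
- exact: measurable_block.
- exact: measurableC.
- by move=> x /= xv Xx; apply: nv; exists x.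
Qed.

(** The complement of [X] is a countable union of events that a centred block lies outside the
    language, and each of them is null. *)
Lemma law_inv_on (mu : probability Omega R) : shift_inv mu ->
  (forall v, ~ in_lang v -> omega_law mu v = 0) -> inv_on X mu.
Proof.
move=> inv mu0; split => //.
have mA N := measurable_in_lang_block (- N%:Z) N.*2.
have A0 N : mu (~` ([set x | in_lang (block (- N%:Z) N.*2 x)] : set Omega)) = 0%E.
  have mCA : measurable (~` ([set x | in_lang (block (- N%:Z) N.*2 x)] : set Omega)).
    exact: measurableC.
  rewrite -[LHS]fineK ?fin_num_measure//; congr _%:E.
  rewrite (@fine_probability_partition _ _ _ mu _ (words bool N.*2)
    (fun x : Omega => block (- N%:Z) N.*2 x))//.
  - apply: big1_seq => v /andP[_]; rewrite mem_words => /eqP sv.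
    have [lv|nlv] := pselect (in_lang v).
      rewrite (_ : _ `&` _ = set0) ?measure0//.
      by apply/seteqP; split => x //= -[nl xv]; apply: nl; rewrite xv.
    rewrite (_ : _ `&` _ = [set x | block (- N%:Z) (size v) x = v]).
      by rewrite -omega_lawE// mu0.
    by rewrite sv; apply/seteqP; split => x /= => [[]//|xv]; split => //; rewrite xv.
  - exact: words_uniq.
  - by move=> x _; rewrite mem_words size_block.
  - by move=> v; exact: measurable_block.
have : mu.-negligible (\bigcup_N (~` ([set x | in_lang (block (- N%:Z) N.*2 x)] : set Omega))).
  apply: negligible_bigcup => N; apply/negligibleP; last exact: A0.
  exact: measurableC.
rewrite -setC_bigcap -subshiftE => /negligibleP h.
have mX := measurable_subshift.
have := probability_setC mu mX; rewrite (h (measurableC mX)) => /esym e.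
have := fin_num_measure mu _ mX; case: (mu X) e => // r.
by rewrite -EFinB => -[] /subr0_eq <-.
Qed.

End Language.

(** * The partition function and the lower bound on the pressure *)

Section PartitionFunction.
Variables (R : realType) (X : set conf) (phi : bool -> R).

Definition pot_sum (v : seq bool) : R := \sum_(b <- v) phi b.

Definition partition_fun n : R :=
  \sum_(v <- words bool n | `[< in_lang X v >]) 2 `^ pot_sum v.

Lemma birkhoff_block n x : birkhoff phi n x = pot_sum (block 0 n x).
Proof.
rewrite /birkhoff /pot_sum /block big_map -(big_mkord predT (fun j => pot phi (iter j shift x))).
rewrite /index_iota subn0; apply: eq_bigr => j _.
by rewrite /pot iter_shiftE.
Qed.

Lemma lang_codom n (w : {ffun 'I_n -> bool}) : lang X w <-> in_lang X (codom w).
Proof.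
have sc : size (codom w) = n by rewrite size_map size_enum_ord.
rewrite /lang /in_lang sc cyl_block; split; by move=> [x Xx xw]; exists x.
Qed.

(** The potential reads only [x_0], so the Birkhoff sum is constant on a cylinder and the supremum
    is over a singleton. *)
Lemma pressureE :
  pressure X phi = limn (fun n => n%:R^-1 * log2 (partition_fun n)).
Proof.
rewrite /pressure; congr (limn _); apply/funext => n; congr (_ * log2 _).
rewrite /partition_fun big_mkcond [RHS]big_mkcond.
rewrite -(sum_ffun_words n (fun v => if `[< in_lang X v >] then 2 `^ pot_sum v else 0)).
apply: eq_bigr => w _; rewrite (asbool_equiv_eq (lang_codom w)).
case: asboolP => // -[x Xx]; rewrite size_map size_enum_ord => xw.
congr (_ `^ _); rewrite (_ : [set _ | _ in _] = [set pot_sum (codom w)]) ?sup1//.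
apply/seteqP; split => y /=.
  by move=> [z [Xz]]; rewrite cyl_block /= => zw <-; rewrite birkhoff_block zw.
by move=> ->; exists x; [split => //; rewrite cyl_block|rewrite birkhoff_block xw].
Qed.

Lemma partition_fun_gt0 n : X !=set0 -> 0 < partition_fun n.
Proof.
move=> [x Xx]; rewrite /partition_fun (big_rem (block 0 n x)) /=; last first.
  by rewrite mem_words size_block.
rewrite asboolT; last by exists x; rewrite ?size_block.
rewrite ltr_pwDl ?powR_gt0//; apply: sumr_ge0 => *; exact: powR_ge0.
Qed.

Lemma pot_sum_law (L : seq bool -> R) n : statlaw L ->
  \sum_(v <- words bool n) L v * pot_sum v = n%:R * \sum_a L [:: a] * phi a.
Proof. by move=> HL; exact: sum_law_additive. Qed.

Lemma mean_potE (mu : probability Omega R) :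
  mean_pot phi mu = \sum_a omega_law mu [:: a] * phi a.
Proof. by rewrite big_bool /mean_pot !omega_law1 addrC. Qed.

(** Gibbs' inequality against the weights [2 ^ phi^(n) / Z] on the language, which carries [mu]. *)
Lemma block_entropy_le_partition (mu : probability Omega R) n :
  subshift X -> X !=set0 -> inv_on X mu ->
  block_entropy (omega_law mu) n + n%:R * mean_pot phi mu <= log2 (partition_fun n).
Proof.
move=> subX X0 imu; have HL := omega_law_statlaw imu.1.
have Z0 := partition_fun_gt0 n X0; set Z := partition_fun n in Z0 *.
pose Q v := if `[< in_lang X v >] then 2 `^ pot_sum v / Z else 0.
have Qpos v : 0 < omega_law mu v -> Q v = 2 `^ pot_sum v / Z.
  by move=> v0; rewrite /Q asboolT//; exact: inv_on_lang v0.
have g : \sum_(v <- words bool n) omega_law mu v * log2 (Q v)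
    <= \sum_(v <- words bool n) omega_law mu v * log2 (omega_law mu v).
  apply: gibbs.
  - by move=> v; exact: law_ge0.
  - by move=> v; rewrite /Q; case: ifP => // _; rewrite divr_ge0 ?powR_ge0// ltW.
  - by move=> v v0; rewrite Qpos// divr_gt0 ?powR_gt0.
  - by rewrite (law_total HL) /Q -big_mkcond -mulr_suml divff// gt_eqF.
have e : \sum_(v <- words bool n) omega_law mu v * log2 (Q v) =
    n%:R * mean_pot phi mu - log2 Z.
  rewrite mean_potE -pot_sum_law// -[log2 Z]mul1r -(law_total HL n) mulr_suml.
  rewrite -sumrB; apply: eq_bigr => v _.
  have := law_ge0 HL v; rewrite le_eqVlt => /predU1P[<-|v0].
    by rewrite !mul0r subr0.
  by rewrite Qpos// log2M ?invr_gt0 ?powR_gt0// log2V// log2_powR mulrBr.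
rewrite e in g; rewrite /block_entropy; lra.
Qed.

End PartitionFunction.

Lemma take_block p j n x : (p <= n)%N -> take p (block j n x) = block j p x.
Proof. by move=> pn; rewrite -(subnKC pn) block_cat take_size_cat ?size_block. Qed.

Lemma behead_block j n x : behead (block j n.+1 x) = block (j + 1) n x.
Proof. by rewrite block_cons. Qed.

(** * Backward Markov weights of finite memory *)

Section BackwardMarkov.
Variables (R : realType) (m : nat) (k : seq bool -> R).
Hypothesis k0 : forall v, 0 < k v.
Hypothesis ksum : forall u, size u = m -> \sum_a k (a :: u) <= 1.

Fixpoint markov_weight l (w : seq bool) : R :=
  if l is l'.+1 then k (take m.+1 w) * markov_weight l' (behead w)
  else 2 ^- m.

Lemma markov_weight_gt0 l w : 0 < markov_weight l w.
Proof.
by elim: l w => [|l ih] w /=; rewrite ?mulr_gt0// invr_gt0 exprn_gt0.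
Qed.

(** The first letter is summed out first: it occurs only in the leading factor, where [ksum]
    applies. *)
Lemma sum_markov_weight l :
  \sum_(w <- words bool (l + m)) markov_weight l w <= 1.
Proof.
elim: l => [|l ih].
  rewrite add0n /= big_const_seq count_predT iter_addr_0.
  have -> : size (words bool m) = (2 ^ m)%N.
    elim: (m) => //= n ihn; rewrite size_allpairs ihn expnS.
    by rewrite -sum1_size big_bool.
  by rewrite -[leLHS]mulr_natl natrX divff// expf_neq0.
rewrite addSn sum_wordsS exchange_big /=; apply: le_trans ih.
rewrite [leLHS]big_seq [leRHS]big_seq; apply: ler_sum => w.
rewrite mem_words => /eqP sw; rewrite -mulr_suml.
apply: ler_piMl; first exact/ltW/markov_weight_gt0.
by apply: ksum; rewrite size_takel// sw leq_addl.
Qed.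

Lemma log2_markov_weight l j x :
  log2 (markov_weight l (block j (l + m) x)) =
  \sum_(i < l) log2 (k (block (j + i%:Z) m.+1 x)) - m%:R.
Proof.
elim: l j => [|l ih] j.
  rewrite big_ord0 sub0r /= log2V ?exprn_gt0//; congr (- _).
  by rewrite /log2 lnXn// -[ln _ *+ _]mulr_natl mulfK// gt_eqF// ln2_gt0.
have mS w : markov_weight l.+1 w = k (take m.+1 w) * markov_weight l (behead w) by [].
rewrite mS log2M ?markov_weight_gt0// [(l.+1 + m)%N]addSn take_block ?ltnS ?leq_addl//.
rewrite behead_block ih big_ord_recl /= addr0 -addrA; congr (_ + (_ - _)).
by apply: eq_bigr => i _; rewrite /bump /= add1n -addrA -PoszD add1n.
Qed.

End BackwardMarkov.

(** * Empirical laws of Gibbs weights *)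

Section EmpiricalLaw.
Variables (R : realType) (X : set conf) (phi : bool -> R).
Hypotheses (subX : subshift X) (X0 : X !=set0).

(** The default value is taken only outside the language, where [gibbs_weight] is 0. *)
Definition lang_point (w : seq bool) : conf :=
  xget (fun=> false) [set x | X x /\ block 0 (size w) x = w].

Lemma lang_pointP w : in_lang X w ->
  X (lang_point w) /\ block 0 (size w) (lang_point w) = w.
Proof.
by move=> [x Xx xw]; apply: (xgetPex (fun=> false : bool)
  (P := [set x | X x /\ block 0 (size w) x = w])); exists x.
Qed.

Let Z := partition_fun X phi.
Let Z0 n : 0 < Z n := partition_fun_gt0 phi n X0.

Definition gibbs_weight n (w : seq bool) : R :=
  if `[< in_lang X w >] then 2 `^ pot_sum phi w / Z n else 0.

Lemma gibbs_weight_ge0 n w : 0 <= gibbs_weight n w.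
Proof.
by rewrite /gibbs_weight; case: ifP => // _; rewrite divr_ge0 ?powR_ge0// ltW.
Qed.

Lemma sum_gibbs_weight n : \sum_(w <- words bool n) gibbs_weight n w = 1.
Proof.
rewrite /gibbs_weight -big_mkcond -mulr_suml divff// gt_eqF//; exact: Z0.
Qed.

Lemma sum_gibbs_weight_const n c :
  \sum_(w <- words bool n) gibbs_weight n w * c = c.
Proof. by rewrite -mulr_suml sum_gibbs_weight mul1r. Qed.

(** All [n] starting positions count, even when the block runs past site [n - 1] and reads the
    chosen point beyond its cylinder. This makes [empirical_law_rcons] exact and confines the defect
    of stationarity to the two ends. *)
Definition occurrences n v (x : conf) : R :=
  \sum_(j < n) (block j%:Z (size v) x == v)%:R.

(* The law of the average of the first [n] translates of the measure giving
   mass [gibbs_weight n w] to one chosen point of [X] in each cylinder [w]. *)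
Definition empirical_law n (v : seq bool) : R :=
  \sum_(w <- words bool n)
    gibbs_weight n w * (n%:R^-1 * occurrences n v (lang_point w)).

Lemma occurrences_ge0 n v x : 0 <= occurrences n v x.
Proof. by apply: sumr_ge0 => j _; exact: ler0n. Qed.

Lemma occurrences_le n v x : occurrences n v x <= n%:R.
Proof.
apply: (@le_trans _ _ (\sum_(j < n) 1)); last by rewrite sumr_const card_ord.
by apply: ler_sum => j _; rewrite lern1 leq_b1.
Qed.

Lemma empirical_law_ge0 n v : 0 <= empirical_law n v.
Proof.
by apply: sumr_ge0 => w _; rewrite !mulr_ge0 ?gibbs_weight_ge0 ?invr_ge0 ?occurrences_ge0.
Qed.

Lemma empirical_law_le1 n v : empirical_law n v <= 1.
Proof.
rewrite -(sum_gibbs_weight n); apply: ler_sum => w _.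
apply: ler_piMr; first exact: gibbs_weight_ge0.
case: n => [|n]; first by rewrite /occurrences big_ord0 mulr0.
by rewrite ler_pdivrMl// mulr1 occurrences_le.
Qed.

Lemma empirical_law_nil n : (0 < n)%N -> empirical_law n [::] = 1.
Proof.
move=> n0; rewrite -(sum_gibbs_weight n); apply: eq_bigr => w _.
rewrite /occurrences /= sumr_const card_ord mulVf ?mulr1//.
by rewrite pnatr_eq0 -lt0n.
Qed.

Lemma empirical_law_rcons n v :
  \sum_a empirical_law n (rcons v a) = empirical_law n v.
Proof.
rewrite /empirical_law exchange_big /=; apply: eq_bigr => w _.
rewrite -mulr_sumr -mulr_sumr /occurrences exchange_big /=.
congr (_ * (_ * _)); apply: eq_bigr => j _.
rewrite big_bool !size_rcons block_rcons /= !eqseq_rcons.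
by case: (lang_point w _); case: (_ == v); rewrite /= ?addr0 ?add0r.
Qed.

(** Prepending a letter moves all occurrences by one site; the difference telescopes to two end
    terms and is at most [1 / n]. *)
Lemma empirical_law_cons n v :
  `|\sum_a empirical_law n (a :: v) - empirical_law n v| <= n%:R^-1.
Proof.
have e x : \sum_a occurrences n (a :: v) x - occurrences n v x =
    (block n%:Z (size v) x == v)%:R - (block 0 (size v) x == v)%:R.
  rewrite /occurrences exchange_big /=.
  rewrite (eq_bigr (fun j : 'I_n => (block j.+1%:Z (size v) x == v)%:R)).
    pose f j : R := (block j%:Z (size v) x == v)%:R.
    rewrite -sumrB -(big_mkord predT (fun j => f j.+1 - f j)).
    by rewrite telescope_sumr.
  move=> j _; rewrite big_bool /= !block_cons !eqseq_cons.
  rewrite -PoszD addn1; case: (x j); case: (_ == v);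
    by rewrite /= ?addr0 ?add0r.
rewrite /empirical_law exchange_big -sumrB /=.
apply: (le_trans (ler_norm_sum _ _ _)).
rewrite -[leRHS](sum_gibbs_weight_const n); apply: ler_sum => w _.
rewrite -mulr_sumr -mulr_sumr -mulrBr -mulrBr normrM ger0_norm ?gibbs_weight_ge0//.
rewrite ler_wpM2l ?gibbs_weight_ge0// e normrM ger0_norm ?invr_ge0//.
rewrite ler_piMr ?invr_ge0//.
by do 2![case: (_ == v)]; rewrite ?subrr ?subr0 ?sub0r ?normrN ?normr0 ?normr1.
Qed.

Lemma empirical_law_lang n v : ~ in_lang X v -> empirical_law n v = 0.
Proof.
move=> nv; apply: big1_seq => w /andP[_ _].
rewrite /gibbs_weight; case: asboolP => [lw|_]; last by rewrite mul0r.
rewrite /occurrences big1 ?mulr0// => j _; case: eqP => // e.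
by case: nv; rewrite -e; apply: in_lang_block => //; exact: (lang_pointP lw).1.
Qed.

Lemma sum_empirical n l (g : seq bool -> R) :
  n%:R * \sum_(v <- words bool l) empirical_law n v * g v =
  \sum_(w <- words bool n) gibbs_weight n w *
    \sum_(j < n) g (block j%:Z l (lang_point w)).
Proof.
rewrite /empirical_law; under eq_bigr do rewrite mulr_suml.
rewrite exchange_big mulr_sumr /=; apply: eq_bigr => w _.
under eq_bigr do rewrite -!mulrA; rewrite -mulr_sumr mulrCA; congr (_ * _).
rewrite -mulr_sumr mulrA; case: n => [|n].
  by rewrite !mul0r big_ord0.
rewrite divff ?pnatr_eq0// mul1r /occurrences.
transitivity (\sum_(v <- words bool l)
    \sum_(j < n.+1) (block j%:Z (size v) (lang_point w) == v)%:R * g v).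
  by apply: eq_bigr => v _; rewrite mulr_suml.
rewrite exchange_big /=; apply: eq_bigr => j _.
rewrite (bigD1_seq (block j%:Z l (lang_point w))) ?words_uniq ?mem_words ?size_block//=.
rewrite eqxx mul1r big1_seq ?addr0// => v /andP[vb]; rewrite mem_words => /eqP ->.
by rewrite eq_sym (negbTE vb) mul0r.
Qed.

(** Gibbs' inequality for the Gibbs weights against the backward Markov weights with kernel [k]; the
    term [m] is the cost of the uniform law on the last [m] letters. *)
Lemma log2_partition_le n m (k : seq bool -> R) : (m <= n)%N ->
  (forall v, 0 < k v) -> (forall v, k v <= 1) ->
  (forall u, size u = m -> \sum_a k (a :: u) <= 1) ->
  log2 (Z n) <= m%:R
    - n%:R * (\sum_(v <- words bool m.+1) empirical_law n v * log2 (k v))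
    + n%:R * (\sum_a empirical_law n [:: a] * phi a).
Proof.
move=> mn k0 k1 ksum.
pose l := (n - m)%N; have nE : n = (l + m)%N by rewrite subnK.
pose s := gibbs_weight n.
have g : \sum_(w <- words bool n) s w * log2 (markov_weight m k l w)
    <= \sum_(w <- words bool n) s w * log2 (s w).
  apply: gibbs.
  - by move=> w; exact: gibbs_weight_ge0.
  - by move=> w; exact/ltW/markov_weight_gt0.
  - by move=> w _; exact: markov_weight_gt0.
  - by rewrite sum_gibbs_weight nE; exact: sum_markov_weight.
(* For the Gibbs weights, entropy plus mean potential is exactly [log2 (Z n)]. *)
have e1 : \sum_(w <- words bool n) s w * log2 (s w) =
    n%:R * (\sum_a empirical_law n [:: a] * phi a) - log2 (Z n).
  rewrite (_ : \sum_a _ = \sum_(v <- words bool 1) empirical_law n v * pot_sum phi v).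
    rewrite sum_empirical -[log2 (Z n)](sum_gibbs_weight_const n) -sumrB.
    apply: eq_big_seq => w; rewrite mem_words => /eqP sw.
    rewrite -mulrBr /s {1 3}/gibbs_weight; case: asboolP => [lw|_]; last by rewrite !mul0r.
    congr (_ * _); rewrite /gibbs_weight asboolT// log2M ?invr_gt0 ?powR_gt0//.
    rewrite log2V// log2_powR; congr (_ - _).
    rewrite -{1}(lang_pointP lw).2 sw -birkhoff_block; apply: eq_bigr => j _.
    by rewrite /pot iter_shiftE add0r /pot_sum /block /= big_seq1 addr0.
  by rewrite sum_wordsS; apply: eq_bigr => a _; rewrite sum_words0 /pot_sum big_seq1.
have e2 : n%:R * (\sum_(v <- words bool m.+1) empirical_law n v * log2 (k v)) - m%:R
    <= \sum_(w <- words bool n) s w * log2 (markov_weight m k l w).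
  rewrite sum_empirical -[m%:R](sum_gibbs_weight_const n) -sumrB.
  rewrite [leLHS]big_seq [leRHS]big_seq; apply: ler_sum => w.
  rewrite mem_words => /eqP sw.
  rewrite -mulrBr /s /gibbs_weight; case: asboolP => [lw|_]; last by rewrite !mul0r.
  apply: ler_wpM2l; first by rewrite divr_ge0 ?powR_ge0// ltW.
  rewrite -[in leRHS](lang_pointP lw).2 sw [X in markov_weight _ _ _ (block _ X _)]nE log2_markov_weight// lerD2r.
  have le N : N = (l + m)%N ->
      \sum_(j < N) log2 (k (block j%:Z m.+1 (lang_point w))) <=
      \sum_(i < l) log2 (k (block (0 + i%:Z) m.+1 (lang_point w))).
    (* The last [m] positions, whose windows of length [m + 1] stick out of [w], contribute terms
       [log2 (k _) <= 0]. *)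
    move=> ->; rewrite big_split_ord /=.
    under [leRHS]eq_bigr do rewrite add0r.
    rewrite gerDl.
    by apply: sumr_le0 => j _; exact: log2_le0.
  exact: le.
rewrite e1 in g; lra.
Qed.

End EmpiricalLaw.

(** * From the partition function to an invariant measure *)

Section VariationalBound.
Variables (R : realType) (X : set conf) (phi : bool -> R).
Hypotheses (subX : subshift X) (X0 : X !=set0).

(** The optimal kernel [P v / P (behead v)] attains the entropy increment but may vanish, so it is
    smoothed by [d] and [d] is made small. *)
Lemma smoothed_kernel_bound (P : seq bool -> R) m c : statlaw P ->
  (forall k : seq bool -> R, (forall v, 0 < k v) -> (forall v, k v <= 1) ->
    (forall u, size u = m -> \sum_a k (a :: u) <= 1) ->
    c <= - \sum_(v <- words bool m.+1) P v * log2 (k v)) ->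
  c <= block_entropy P m.+1 - block_entropy P m.
Proof.
move=> HP h; pose C : R := \sum_(u <- words bool m) 2 / ln 2.
have C0 : 0 <= C by apply: sumr_ge0 => u _; rewrite divr_ge0// ltW// ln2_gt0.
apply/ler_addgt0Pr => e e0; pose d := e / (C + 1).
have d0 : 0 < d by rewrite divr_gt0//; lra.
have dC : d * C <= e.
  by rewrite /d mulrAC ler_pdivrMr; [rewrite ler_pM2l//; lra|lra].
(* Adding [d] to the numerator for each of the two letters and [2 * d] to the denominator keeps the
   kernel normalised. *)
pose k v := (P v + d) / (P (behead v) + 2 * d).
have d2 : 0 <= 2 * d by rewrite mulr_ge0// ltW.
have den v : 0 < P (behead v) + 2 * d.
  by have := law_ge0 HP (behead v); lra.
have num v : 0 < P v + d by have := law_ge0 HP v; lra.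
have kpos v : 0 < k v by rewrite divr_gt0.
apply: (le_trans (h k kpos _ _)).
- move=> v; rewrite /k ler_pdivrMr// mul1r.
  suff : P v <= P (behead v) by lra.
  by case: v => // a v; exact: (law_le_catr HP [:: a] v).
- move=> u _; rewrite big_bool /k /= -mulrDl ler_pdivrMr; last first.
    exact: (den (true :: u)).
  rewrite mul1r.
  by rewrite -(law_cons HP u) big_bool /=; lra.
have up : - \sum_(v <- words bool m.+1) P v * log2 (k v) <=
   block_entropy P m.+1 +
   \sum_(v <- words bool m.+1) P v * log2 (P (behead v) + 2 * d).
  rewrite /block_entropy -!sumrN -big_split /=; apply: ler_sum => v _.
  have := law_ge0 HP v; rewrite le_eqVlt => /predU1P[<-|v0].
    by rewrite !mul0r addr0.
  rewrite /k log2M ?invr_gt0// log2V// mulrBr.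
  suff : P v * log2 (P v) <= P v * log2 (P v + d) by lra.
  by rewrite ler_pM2l// ler_log2//; lra.
have sm : \sum_(v <- words bool m.+1) P v * log2 (P (behead v) + 2 * d)
    = \sum_(u <- words bool m) P u * log2 (P u + 2 * d).
  rewrite -(sum_law_catr HP 1 m (fun u => log2 (P u + 2 * d))).
  by apply: eq_bigr => v _; rewrite drop1.
(* By [log2D_le] each word costs at most [2 * d / ln 2], hence [d * C] in all. *)
have lo : \sum_(u <- words bool m) P u * log2 (P u + 2 * d) <=
    - block_entropy P m + d * C.
  rewrite /block_entropy opprK /C mulr_sumr -big_split /=; apply: ler_sum => u _.
  have := law_ge0 HP u; rewrite le_eqVlt => /predU1P[<-|u0].
    by rewrite !mul0r add0r mulr_ge0 ?(ltW d0)// divr_ge0// ltW// ln2_gt0.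
  by have := log2D_le u0 d2; rewrite [d * _]mulrCA mulrA.
apply: (le_trans up); rewrite sm -addrA lerD2l.
by apply: (le_trans lo); rewrite lerD2l.
Qed.

(* Misiurewicz's construction of a measure of large free energy, with an
   ultrafilter limit of empirical laws. *)
Lemma exists_inv_on_ge (U : set_system nat) c : UltraFilter U ->
  (forall N, U [set n | (N <= n)%N]) ->
  U [set n | c <= n%:R^-1 * log2 (partition_fun X phi n)] ->
  exists2 mu : probability Omega R, inv_on X mu &
    forall m, m%:R * c <= block_entropy (omega_law mu) m + m%:R * mean_pot phi mu.
Proof.
move=> UU Uoo Uc.
have UF : ProperFilter U := @ultra_proper _ _ UU.
have PU v : exists l : R, (fun n => empirical_law X phi n v) @ U --> l.
  by apply: ultra_bounded_cvg => n; rewrite empirical_law_ge0// empirical_law_le1.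
have [P PE] := choice PU.
have inv0 : (fun n => n%:R^-1 : R) @ U --> (0 : R).
  apply/cvgrPdist_le => e e0.
  have [N _ hN] : \forall n \near \oo, e^-1 <= n%:R by exact: nbhs_infty_ger.
  apply: filterS (Uoo N.+1) => n Nn; rewrite sub0r normrN ger0_norm ?invr_ge0//.
  have n0 : 0 < n%:R :> R by rewrite ltr0n (leq_ltn_trans (leq0n N)).
  by rewrite invf_ple ?posrE//; apply: hN; exact: ltnW.
have Usum (I : Type) (r : seq I) (f : I -> nat -> R) (l : I -> R) :
    (forall i, f i @ U --> l i) ->
    (fun n => \sum_(i <- r) f i n) @ U --> \sum_(i <- r) l i.
  move=> fl; elim: r => [|i r ih].
    rewrite big_nil (_ : (fun _ => _) = fun=> 0); first exact: cvg_cst.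
    by apply/funext => n; rewrite big_nil.
  rewrite big_cons (_ : (fun _ => _) = fun n => f i n + \sum_(j <- r) f j n).
    exact: cvgD.
  by apply/funext => n; rewrite big_cons.
have Ueq (f : nat -> R) (l l' : R) : f @ U --> l -> U [set n | f n = l'] -> l = l'.
  move=> fl fl'; apply: (cvg_unique (@norm_hausdorff _ R) fl).
  exact: cvg_near_cst.
have HP : statlaw P.
  split.
  - move=> v; apply: ler_cvg_to (cvg_cst (0 : R)) (PE v) _.
    by apply: nearW => n; exact: empirical_law_ge0.
  - apply: Ueq (PE [::]) _; apply: filterS (Uoo 1%N) => n n0.
    exact: empirical_law_nil.
  (* Empirical laws are stationary only up to [1 / n], which vanishes along [U]. *)
  - move=> v; apply/eqP; rewrite -subr_eq0 eq_le.
    have D : (fun n => \sum_a empirical_law X phi n (a :: v) - empirical_law X phi n v)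
        @ U --> \sum_a P (a :: v) - P v.
      by apply: cvgB => //; apply: Usum => a; exact: PE.
    apply/andP; split.
      apply: ler_cvg_to D inv0 _; apply: nearW => n.
      by apply: le_trans (ler_norm _) _; exact: empirical_law_cons.
    have Ninv0 : (fun n => - n%:R^-1 : R) @ U --> (0 : R).
      by rewrite -oppr0; exact: cvgN.
    apply: ler_cvg_to Ninv0 D _; apply: nearW => n.
    rewrite lerNl; apply: le_trans (ler_norm _) _.
    by rewrite normrN; exact: empirical_law_cons.
  - move=> v; apply: (cvg_unique (@norm_hausdorff _ R) _ (PE v)).
    rewrite (_ : (fun n => _) = fun n => \sum_a empirical_law X phi n (rcons v a)).
      by apply: Usum => a; exact: PE.
    by apply/funext => n; rewrite empirical_law_rcons.
have [mu [inv law]] := measure_of_law HP.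
exists mu.
  apply: law_inv_on => // v nv; rewrite law.
  by apply: Ueq (PE v) _; apply: filterE => n; exact: empirical_law_lang.
have {law} lawE : omega_law mu = P by apply/funext.
(* The bound on [log2 (Z n)] is divided by [n] and passed to the limit for each kernel; the kernel
   is optimised afterwards. *)
have step m : c <= block_entropy P m.+1 - block_entropy P m + mean_pot phi mu.
  rewrite -lerBlDr; apply: smoothed_kernel_bound => // k k0 k1 ksum.
  rewrite lerBlDr mean_potE lawE.
  have lim : (fun n => n%:R^-1 * m%:R
      - \sum_(v <- words bool m.+1) empirical_law X phi n v * log2 (k v)
      + \sum_a empirical_law X phi n [:: a] * phi a) @ U -->
      0 * m%:R - \sum_(v <- words bool m.+1) P v * log2 (k v)
      + \sum_a P [:: a] * phi a.
    apply: cvgD; [apply: cvgB; [exact: cvgMl|]|].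
    - by apply: Usum => v; apply: cvgMl; exact: PE.
    - by apply: Usum => a; apply: cvgMl; exact: PE.
  rewrite mul0r sub0r in lim; apply: ler_cvg_to (cvg_cst c) lim _.
  apply: filterS (filterI Uc (filterI (Uoo m) (Uoo 1%N))) => n [cn [mn n0]]; apply: (le_trans cn).
  have nR : 0 < n%:R :> R by rewrite ltr0n.
  rewrite ler_pdivrMl//; apply: le_trans (log2_partition_le phi X0 mn k0 k1 ksum) _.
  by rewrite mulrDr mulrBr mulVKf// gt_eqF.
(* The entropy increments telescope over [m]. *)
rewrite lawE; elim=> [|m ih]; first by rewrite !mul0r addr0 block_entropy_ge0.
by have := step m; rewrite -natr1 !mulrDl !mul1r; lra.
Qed.

End VariationalBound.

(** * The value of the pressure *)

Section Pressure.
Variables (R : realType) (X : set conf) (nu : probability Omega R).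
Variable phi : bool -> R.
Hypotheses (inu : shift_inv nu) (hX : mt_subordinate X nu).
Hypothesis entropy0 : entropy nu = 0.

(** The lower bound holds at every [n]. If the upper bound failed by [e] infinitely often, an
    ultrafilter on those [n] would give an invariant measure on [X] violating the block
    inequality. *)
Lemma pressure_masked (mu : probability Omega R) : inv_on X mu ->
  (forall n, n%:R * (target_pressure phi nu - mean_pot phi mu)
             <= block_entropy (omega_law mu) n) ->
  pressure X phi = target_pressure phi nu.
Proof.
set F := target_pressure phi nu => imu low.
have subX := hX.1.
have X0 : X !=set0.
  apply/set0P/eqP => X0; have := imu.2; rewrite X0 measure0 => /eqP.
  by rewrite eqe eq_sym oner_eq0.
have low2 n : n%:R * F <= log2 (partition_fun X phi n).
  have := block_entropy_le_partition phi n subX X0 imu.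
  by have := low n; rewrite mulrBr; lra.
rewrite pressureE; apply: cvg_lim => //; apply/cvgrPdist_le => e e0.
suff up : \forall n \near \oo, n%:R^-1 * log2 (partition_fun X phi n) < F + e.
  near=> n; have n0 : 0 < n%:R :> R by rewrite ltr0n; near: n; exists 1%N.
  rewrite distrC ger0_norm.
    by rewrite lerBlDl ltW//; near: n.
  by rewrite subr_ge0 mulrC ler_pdivlMr// mulrC.
apply: contrapT => nup.
pose A := [set n | F + e <= n%:R^-1 * log2 (partition_fun X phi n)].
(* [A] meets every cofinite set, as otherwise the upper bound would hold eventually. *)
have GF : ProperFilter (within A \oo).
  apply: Build_ProperFilter_ex => B hB; apply: contrapT => nB; apply: nup.
  move: hB; rewrite /within /=; apply: filterS => n h.
  by rewrite ltNge; apply/negP => An; apply: nB; exists n; exact: h.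
have [U [UU sub]] := ultraFilterLemma GF.
have [||lam ilam hlam] := @exists_inv_on_ge R X phi subX X0 U (F + e) UU.
- by move=> N; apply: sub; rewrite /within /=; exists N.
- by apply: sub; rewrite /within /=; apply: nearW.
(* The two block inequalities give [m * e <= H_m(nu)], which is [o(m)]. *)
have : e <= 0.
  apply: ler_cvg_to (cvg_cst e) (block_entropy_base_cvg inu entropy0) _.
  exists 1%N => // m /= m1; have mR : 0 < m%:R :> R by rewrite ltr0n.
  rewrite ler_pdivlMl//.
  have := hlam m; have := block_entropy_inv_le phi inu hX m ilam.
  by rewrite -/F mulrDr; lra.
by rewrite leNgt e0.
Unshelve. all: by end_near.
Qed.

End Pressure.

Unset Implicit Arguments.

Theorem theorem5p2 (R : realType) (X : set conf) (nu : probability Omega R)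
  (phi : bool -> R) :
  shift_inv nu ->
  mt_subordinate X nu ->
  entropy nu = 0 ->
  let p := (2 : R) `^ phi false / ((2 : R) `^ phi false + (2 : R) `^ phi true) in
  pressure X phi =
    sym_prob nu false * phi false
    + sym_prob nu true * log2 ((2 : R) `^ phi false + (2 : R) `^ phi true) /\
  exists mu : probability Omega R,
    [/\ equilibrium X phi mu,
        (exists (beta : probability Omega R) (lam : probability (Omega * Omega)%type R),
            [/\ bernoulli_seq p beta, is_product nu beta lam & is_push_M mu lam])
      & forall mu' : probability Omega R, equilibrium X phi mu' ->
          forall A : set Omega, measurable A -> mu' A = mu A].
Proof.
move=> inu hX h0 p.
have [mu [beta [lam [[imu bs pr push] [ilam lnu law]]]]] :=
  masked_bernoulli_exists phi inu hX.
have [low fe] := free_energy_masked inu hX h0 imu ilam lnu push law.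
split; first exact: pressure_masked low.
exists mu; split.
- by split=> // mu' imu'; rewrite fe; exact: (free_energy_le phi inu hX h0 imu').
- by exists beta, lam.
- move=> mu' [imu' max] A mA.
  have [lam' [ilam' [lnu' push']]] := (hX.2 mu').1 imu'.
  have ge : target_pressure phi nu <= free_energy phi mu' by rewrite -fe max.
  (* Both joinings have the same joint block law, so their product marginals agree on all blocks and
     hence as measures. *)
  have law' := equilibrium_joint_law inu h0 imu' ge ilam' lnu' push'.
  apply: (omega_law_unique imu'.1 imu.1 _ mA) => v.
  rewrite -(joint_law_snd v push') -(joint_law_snd v push).
  by apply: eq_bigr => w _; rewrite law law'.
Qed.
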